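(* Let $n\geqslant3$, assume that $A$ has compact resolvent on $X$, and let $\varLambda_n:D(\varLambda_n)\subset Y\to Y$ be the unbounded linear operator with $$D(\varLambda_n)=X^1\times X^{\frac{n-1}{n}}\times X^{\frac{n-2}{n}}\times\cdots\times X^{\frac1n},\qquad \varLambda_n\,(v_1,v_2,\ldots,v_{n-1},v_n)^{T}=(-v_2,-v_3,\ldots,-v_n,\,Av_1)^{T}.$$ For each $0<\alpha\leqslant1$, the point spectrum of $-\varLambda_n^\alpha$ consists of the eigenvalues $$\bigcup_{k=0}^{\lfloor\frac{n-1}{2}\rfloor}\left(\left\{\mu_j^{\frac{\alpha}{n}}e^{i\frac{\pi(n-(n-2k-1)\alpha)}{n}}:\ j\in\mathbb{N}\right\}\cup\left\{\mu_j^{\frac{\alpha}{n}}e^{i\frac{\pi(n+(n-2k-1)\alpha)}{n}}:\ j\in\mathbb{N}\right\}\right),$$ where $\{\mu_j\}_{j\in\mathbb{N}}$ denotes the ordered sequence of eigenvalues of $A$ including their multiplicity and $\lfloor x\rfloor:=\max\{z\in\mathbb{Z}: z\leqslant x\}$.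
   Context: $X$ is a separable complex Hilbert space and $A:D(A)\subset X\to X$ is an unbounded, closed, densely defined, self-adjoint and positive definite linear operator; there is $\lambda_0>0$ with $\mathrm{Re}\,\lambda>\lambda_0$ for all $\lambda\in\sigma(A)$. For $0<\alpha<1$, $A^\alpha$ is the fractional power of $A$ (the usual closed operator, given by Balakrishnan's formula $A^\alpha=\frac{\sin(\alpha\pi)}{\pi}\int_0^\infty\lambda^{\alpha-1}A(\lambda I+A)^{-1}\,d\lambda$, equivalently by the spectral theorem), with $A^0=I$, $A^1=A$. For $0\leqslant\alpha\leqslant1$, $X^\alpha:=D(A^\alpha)$ with norm $\|x\|_{X^\alpha}=\|A^\alpha x\|_X$, and $X^0=X$. The phase space is $Y=X^{\frac{n-1}{n}}\times X^{\frac{n-2}{n}}\times\cdots\times X^{\frac1n}\times X$ (the $i$-th factor is $X^{\frac{n-i}{n}}$, $1\leqslant i\leqslant n$), with norm given by $\|(v_1,\ldots,v_n)\|_Y^2=\sum_{i=1}^n\|v_i\|^2_{X^{\frac{n-i}{n}}}$. For $0<\alpha<1$, $\varLambda_n^\alpha$ is the fractional power in the usual sense for operators of positive type: the closed operator $\varLambda_n^\alpha=(\varLambda_n^{-\alpha})^{-1}$, where $\varLambda_n^{-\alpha}=\frac{\sin(\alpha\pi)}{\pi}\int_0^\infty\lambda^{-\alpha}(\lambda I+\varLambda_n)^{-1}\,d\lambda$ is a bounded injective operator on $Y$ (equivalently, on $D(\varLambda_n)$, $\varLambda_n^\alpha=\frac{\sin(\alpha\pi)}{\pi}\int_0^\infty\lambda^{\alpha-1}\varLambda_n(\lambda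 I+\varLambda_n)^{-1}\,d\lambda$); also $\varLambda_n^1=\varLambda_n$. *)

(* Defs.v *)
From Stdlib Require Import Reals Lra FunctionalExtensionality.
From Coquelicot Require Import Coquelicot.
From mathcomp Require Import ssreflect ssrfun ssrbool eqtype ssrnat seq.
From mathcomp Require Import fintype bigop.

Set Implicit Arguments.
Unset Strict Implicit.
Unset Printing Implicit Defensive.

Open Scope R_scope.

Section FunctionModule.
Variables (I : Type) (V : ModuleSpace C_Ring).
Implicit Types f g h : I -> V.

Lemma fct_plusC f g :
  (fun i => plus (f i) (g i)) = (fun i => plus (g i) (f i)).
Proof. by apply: functional_extensionality => i; exact: plus_comm. Qed.

Lemma fct_plusA f g h :
  (fun i => plus (f i) (plus (g i) (h i))) =
  (fun i => plus (plus (f i) (g i)) (h i)).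
Proof. by apply: functional_extensionality => i; exact: plus_assoc. Qed.

Lemma fct_plus0 f : (fun i => plus (f i) zero) = f.
Proof. by apply: functional_extensionality => i; exact: plus_zero_r. Qed.

Definition fct_AbelianMonoid_mixin :=
  @AbelianMonoid.Mixin (I -> V) (fun f g i => plus (f i) (g i))
    (fun _ => zero) fct_plusC fct_plusA fct_plus0.

Canonical fct_AbelianMonoid :=
  AbelianMonoid.Pack (I -> V) fct_AbelianMonoid_mixin (I -> V).

Lemma fct_plusN f : plus f (fun i => opp (f i)) = zero.
Proof. by apply: functional_extensionality => i; exact: plus_opp_r. Qed.

Definition fct_AbelianGroup_mixin :=
  @AbelianGroup.Mixin fct_AbelianMonoid (fun f i => opp (f i)) fct_plusN.

Canonical fct_AbelianGroup :=
  AbelianGroup.Pack (I -> V)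
    (AbelianGroup.Class _ _ fct_AbelianGroup_mixin) (I -> V).

Definition fct_scal (c : C_Ring) f : fct_AbelianGroup :=
  fun i => scal c (f i).

Lemma fct_scalA (c d : C_Ring) f :
  fct_scal c (fct_scal d f) = fct_scal (mult c d) f.
Proof. by apply: functional_extensionality => i; exact: scal_assoc. Qed.

Lemma fct_scal1 f : fct_scal one f = f.
Proof. by apply: functional_extensionality => i; exact: scal_one. Qed.

Lemma fct_scalDr (c : C_Ring) f g :
  fct_scal c (plus f g) = plus (fct_scal c f) (fct_scal c g).
Proof. by apply: functional_extensionality => i; exact: scal_distr_l. Qed.

Lemma fct_scalDl (c d : C_Ring) f :
  fct_scal (plus c d) f = plus (fct_scal c f) (fct_scal d f).
Proof. by apply: functional_extensionality => i; exact: scal_distr_r. Qed.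

Definition fct_ModuleSpace_mixin :=
  @ModuleSpace.Mixin C_Ring fct_AbelianGroup fct_scal
    fct_scalA fct_scal1 fct_scalDr fct_scalDl.

Canonical fct_ModuleSpace :=
  ModuleSpace.Pack C_Ring (I -> V)
    (ModuleSpace.Class C_Ring _ _ fct_ModuleSpace_mixin) (I -> V).

End FunctionModule.

(* Coquelicot's Riemann integral is stated for modules over R. *)
Section RealModule.
Variable V : ModuleSpace C_Ring.

Definition real_scal (r : R_Ring) (x : V) : V := scal (RtoC r : C_Ring) x.

Lemma real_scalA (r s : R_Ring) (x : V) :
  real_scal r (real_scal s x) = real_scal (mult r s) x.
Proof.
rewrite /real_scal scal_assoc; congr (scal _ x).
by rewrite [RHS]RtoC_mult.
Qed.

Lemma real_scal1 (x : V) : real_scal one x = x.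
Proof. exact: (scal_one x). Qed.

Lemma real_scalDr (r : R_Ring) (x y : V) :
  real_scal r (plus x y) = plus (real_scal r x) (real_scal r y).
Proof. exact: scal_distr_l. Qed.

Lemma real_scalDl (r s : R_Ring) (x : V) :
  real_scal (plus r s) x = plus (real_scal r x) (real_scal s x).
Proof.
rewrite /real_scal -scal_distr_r; congr (scal _ x).
by rewrite [LHS]RtoC_plus.
Qed.

Definition real_ModuleSpace_mixin :=
  @ModuleSpace.Mixin R_Ring V real_scal
    real_scalA real_scal1 real_scalDr real_scalDl.

Definition real_ModuleSpace : ModuleSpace R_Ring :=
  ModuleSpace.Pack R_Ring V
    (ModuleSpace.Class R_Ring _ _ real_ModuleSpace_mixin) V.

End RealModule.

Section RealNormedModule.
Variable V : NormedModule C_AbsRing.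

Definition real_NormedModuleAux : NormedModuleAux R_AbsRing :=
  NormedModuleAux.Pack R_AbsRing V
    (NormedModuleAux.Class R_AbsRing V
       (ModuleSpace.class R_Ring (real_ModuleSpace V))
       (UniformSpace.class V)) V.

Lemma real_norm_scal (r : R_AbsRing) (x : real_NormedModuleAux) :
  @norm _ V (scal r x) <= abs r * @norm _ V x.
Proof.
have := norm_scal (RtoC r : C_AbsRing) (x : V).
by rewrite [abs (RtoC r : C_AbsRing)]Cmod_R.
Qed.

Definition real_NormedModule_mixin :=
  @NormedModule.Mixin R_AbsRing real_NormedModuleAux
    (@norm _ V) (@norm_factor _ V) (@norm_triangle _ V) real_norm_scal
    (@norm_compat1 _ V) (@norm_compat2 _ V) (@norm_eq_zero _ V).

Definition real_NormedModule : NormedModule R_AbsRing :=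
  NormedModule.Pack R_AbsRing V
    (NormedModule.Class R_AbsRing V _ real_NormedModule_mixin) V.

End RealNormedModule.

Record HilbertSpace := {
  hilbert_space :> CompleteNormedModule C_AbsRing;
  inner : hilbert_space -> hilbert_space -> C;
  inner_plus_l : forall x y z : hilbert_space,
    inner (plus x y) z = (inner x z + inner y z)%C;
  inner_scal_l : forall (c : C) (x y : hilbert_space),
    inner (scal c x) y = (c * inner x y)%C;
  inner_conj : forall x y : hilbert_space, inner y x = Cconj (inner x y);
  inner_norm : forall x : hilbert_space, inner x x = RtoC (norm x ^ 2)
}.

Definition tends_to (X : HilbertSpace) (u : nat -> X) (x : X) : Prop :=
  filterlim u eventually (locally x).

Definition separable (X : HilbertSpace) : Prop :=
  exists s : nat -> X, forall (x : X) (eps : posreal),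
    exists k, norm (minus (s k) x) < eps.

(* An operator is given by its graph: [T x y] means "x in D(T) and T x = y" *)

Definition operator (E : ModuleSpace C_Ring) := E -> E -> Prop.

Section Operators.
Variable E : ModuleSpace C_Ring.
Implicit Types (S T : operator E) (z : C) (x y : E).

Definition domain T x : Prop := exists y, T x y.

Definition linear_operator T : Prop :=
  [/\ forall x y y', T x y -> T x y' -> y = y',
      T zero zero,
      forall x x' y y', T x y -> T x' y' -> T (plus x x') (plus y y') &
      forall z x y, T x y -> T (scal z x) (scal z y)].

Definition id_op : operator E := fun x y => y = x.
Definition opp_op T : operator E := fun x y => T x (opp y).
Definition inv_op T : operator E := fun x y => T y x.
Definition comp_op S T : operator E := fun x y => exists2 t, T x t & S t y.

(* z I + T *)
Definition shift_op z T : operator E := fun x y => T x (minus y (scal z x)).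

Definition point_spectrum T z : Prop :=
  exists2 x : E, x <> zero & T x (scal z x).

End Operators.

Section HilbertOperators.
Variable X : HilbertSpace.
Implicit Types (A K : operator X) (z : C) (x y : X).

Definition closed_operator A : Prop :=
  forall (u v : nat -> X) x y, (forall k, A (u k) (v k)) ->
    tends_to u x -> tends_to v y -> A x y.

Definition op_closure A : operator X := fun x y =>
  exists u v : nat -> X,
    [/\ forall k, A (u k) (v k), tends_to u x & tends_to v y].

Definition densely_defined A : Prop :=
  forall x (eps : posreal),
    exists2 x', domain A x' & norm (minus x' x) < eps.

Definition bounded_operator A : Prop :=
  exists M : R, forall x y, A x y -> norm y <= M * norm x.

Definition adjoint A : operator X := fun y w =>
  forall x Ax, A x Ax -> inner Ax y = inner x w.

Definition self_adjoint A : Prop := forall x y, adjoint A x y <-> A x y.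

Definition positive_definite A : Prop :=
  forall x Ax, A x Ax -> x <> zero ->
    0 < Re (inner Ax x) /\ Im (inner Ax x) = 0.

Definition resolvent z A : operator X := inv_op (shift_op z (opp_op A)).

Definition resolvent_set A z : Prop :=
  (forall y, exists! x, resolvent z A y x) /\ bounded_operator (resolvent z A).

Definition spectrum A z : Prop := ~ resolvent_set A z.

Definition compact_operator K : Prop :=
  (forall x, domain K x) /\
  forall u v : nat -> X,
    (exists M : R, forall k, norm (u k) <= M) ->
    (forall k, K (u k) (v k)) ->
    exists (phi : nat -> nat) (l : X),
      (forall k, (phi k < phi k.+1)%N) /\ tends_to (fun k => v (phi k)) l.

Definition compact_resolvent A : Prop :=
  exists2 z, resolvent_set A z & compact_operator (resolvent z A).

Definition lin_comb d (b : 'I_d -> X) (c : 'I_d -> C) : X :=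
  \big[plus/zero]_(i < d) scal (c i) (b i).

Definition has_dim (P : X -> Prop) (d : nat) : Prop :=
  exists b : 'I_d -> X,
    (forall c, P (lin_comb b c)) /\
    (forall x, P x -> exists! c, x = lin_comb b c).

(* Each complex z occurs in the sequence exactly dim ker(z I - A) times; in
   particular all eigenvalues are real and have finite multiplicity. *)
Definition ordered_eigenvalues A (mu : nat -> R) : Prop :=
  (forall j, mu j <= mu j.+1) /\
  forall z, exists s : seq nat,
    [/\ uniq s, forall j, j \in s <-> RtoC (mu j) = z &
        has_dim (fun x => A x (scal z x)) (size s)].

(* The integral of f over (0, +oo) in X equals J. *)
Definition is_int (f : R -> X) (J : X) : Prop :=
  @is_RInt_gen (real_NormedModule X) f
    (at_right 0) (Rbar_locally p_infty) J.

(* Balakrishnan's formula on D(A), 0 < alpha < 1 *)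
Definition balakrishnan A (alpha : R) : operator X := fun x y =>
  domain A x /\
  exists (h : R -> X) (J : X),
    [/\ forall l, 0 < l -> comp_op A (inv_op (shift_op (RtoC l) A)) x (h l),
        is_int (fun l => scal (RtoC (Rpower l (alpha - 1))) (h l)) J &
        y = scal (RtoC (sin (alpha * PI) / PI)) J].

(* meant for 0 <= alpha <= 1 *)
Definition fpow A (alpha : R) : operator X :=
  if Req_EM_T alpha 0 then @id_op X
  else if Req_EM_T alpha 1 then A
  else op_closure (balakrishnan A alpha).

Definition Xpow A (alpha : R) : X -> Prop := domain (fpow A alpha).

Variables (A : operator X) (n : nat).

(* Indices start at 0: factor i is X^((n-1-i)/n). *)
Definition Yexp (i : 'I_n) : R := INR (n - 1 - i) / INR n.

Definition Yspace (v : 'I_n -> X) : Prop := forall i, Xpow A (Yexp i) (v i).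

(* "v in Y and |v|_Y = r" *)
Definition Ynorm (v : 'I_n -> X) (r : R) : Prop :=
  exists w : 'I_n -> X,
    (forall i, fpow A (Yexp i) (v i) (w i)) /\
    r = sqrt (\big[Rplus/0]_(i < n) norm (w i) ^ 2).

Definition locally_Y (l : 'I_n -> X) (P : ('I_n -> X) -> Prop) : Prop :=
  exists eps : posreal, forall v r, Ynorm (minus v l) r -> r < eps -> P v.

(* is_RInt and is_RInt_gen, with limits taken for the norm of Y *)
Definition is_RInt_Y (f : R -> 'I_n -> X) (a b : R) (J : 'I_n -> X) : Prop :=
  Yspace J /\
  filterlim
    (fun ptd => scal (RtoC (sign (b - a)))
       (@Riemann_sum (real_ModuleSpace (fct_ModuleSpace 'I_n X)) f ptd
        : 'I_n -> X))
    (Riemann_fine a b) (locally_Y J).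

Definition is_int_Y (f : R -> 'I_n -> X) (J : 'I_n -> X) : Prop :=
  Yspace J /\
  filterlimi (fun ab : R * R => is_RInt_Y f ab.1 ab.2)
    (filter_prod (at_right 0) (Rbar_locally p_infty)) (locally_Y J).

(* T^(-alpha), for T of positive type in Y and 0 < alpha < 1 *)
Definition fpow_neg_Y (T : operator (fct_ModuleSpace 'I_n X)) (alpha : R) :
    operator (fct_ModuleSpace 'I_n X) := fun w v =>
  Yspace w /\
  exists (g : R -> 'I_n -> X) (J : 'I_n -> X),
    [/\ forall l, 0 < l ->
          Yspace (g l) /\ inv_op (shift_op (RtoC l) T) w (g l),
        is_int_Y (fun l => scal (RtoC (Rpower l (- alpha))) (g l)) J &
        v = scal (RtoC (sin (alpha * PI) / PI)) J].

(* meant for 0 < alpha <= 1 *)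
Definition fpow_Y (T : operator (fct_ModuleSpace 'I_n X)) (alpha : R) :
    operator (fct_ModuleSpace 'I_n X) :=
  if Req_EM_T alpha 1 then T else inv_op (fpow_neg_Y T alpha).

(* ordS is the cyclic successor of 'I_n, so that component n-1 reads A v_0. *)
Definition Lambda : operator (fct_ModuleSpace 'I_n X) := fun v w =>
  (forall i : 'I_n, Xpow A (INR (n - i) / INR n) (v i)) /\
  forall i : 'I_n,
    if (i.+1 < n)%N then w i = opp (v (ordS i)) else A (v (ordS i)) (w i).

End HilbertOperators.

Arguments Lambda {X} A n v w.

(* r e^(i theta) *)
Definition polar (r theta : R) : C := (r * cos theta, r * sin theta).

(* Main.v *)
Require Import Defs.
From HB Require Import structures.
From Stdlib Require Import Reals Lra Lia Classical ClassicalEpsilon.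
From Stdlib Require Import FunctionalExtensionality.
From Coquelicot Require Import Coquelicot.
From mathcomp Require Import ssreflect ssrfun ssrbool eqtype ssrnat seq.
From mathcomp Require Import div fintype bigop.

Open Scope R_scope.

(* If [A e = m e] and [zeta^n = - m], the vector [(zeta^i e)_i] is an
   eigenvector of [Lambda] for [- zeta], and the linear form
   [v |-> sum_i zeta^(n-1-i) <v_i, e>] is a left eigenvector for [- zeta].
   Both turn the integral defining [Lambda^(-a)] into the scalar integral
   [int_0^oo l^(-a) / (l + c) dl = PI / sin (PI a) c^(-a)] with [c = - zeta]
   outside the negative half-line; the vector shows that every listed number is
   an eigenvalue of [- Lambda^a], and the form that an eigenvalue [z] with
   eigenvector [x] satisfies [z = - (- zeta)^a] as soon as the form does not
   vanish at [x].  Such a form exists for every [x <> 0] because the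
   eigenvectors of [A] are complete (compact resolvent) and the [n] roots
   [zeta] separate the coefficients [<x_i, e>].
   The scalar integral reduces to [c = 1] by rotation and scaling, and its value
   there follows from a duplication formula. *)

(** * The scalar integral *)

(** On vectors whose components are all multiples of [e], [Lambda] acts as a cyclic n by n matrix
    with entries - 1 and one corner [m]; the vector and the form above are its right and left
    eigenvectors. The difficulty is that [Lambda^(-a)] is given only as a relation, through some
    curve [g] and some integral [J] taken in the norm of Y. For an arbitrary eigenvector all that is
    known of [g] is [(l + Lambda) (g l) = w]. The form turns this into
    [(l + c) form (g l) = form w], which determines the scalar integrand, and it passes through the
    integral because it is continuous for the norm of Y, by [<A^t v, e> = m^t <v, e>]. In the other
    direction [g] stays on one complex line, where convergence in Y is convergence in C. For [zeta]
    of argument [PI (2 k + 1) / n] with [0 <= k < n], the argument [PI (2 k + 1) / n - PI] of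
    [- zeta] lies strictly between - PI and PI, so the powers are principal ones. Replacing [k] by
    [n - 1 - k] changes its sign, which is how the n roots fold into two families. *)

Local Notation zero_infty := (filter_prod (at_right 0) (Rbar_locally p_infty)).

Lemma near_zero_infty (P : R * R -> Prop) (d M : R) :
  0 < d -> (forall a b, 0 < a < d -> M < b -> P (a, b)) -> zero_infty P.
Proof.
move=> d0 H.
apply: (Filter_prod _ _ _ (fun a => 0 < a < d) (fun b => M < b)).
- exists (mkposreal d d0) => y; rewrite /ball /= /AbsRing_ball /abs /minus /plus /opp /=.
  by move=> /Rabs_def2; lra.
- by exists M.
- by move=> a b; apply: H.
Qed.

Lemma zero_infty_imp (P Q : R * R -> Prop) :
  (forall ab, P ab -> Q ab) -> zero_infty P -> zero_infty Q.
Proof. exact: filter_imp. Qed.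

Lemma zero_infty_and (P Q : R * R -> Prop) :
  zero_infty P -> zero_infty Q -> zero_infty (fun ab => P ab /\ Q ab).
Proof. exact: filter_and. Qed.

Lemma zero_infty_locally (U : UniformSpace) (F : R * R -> U) (l : U) :
  filterlim F zero_infty (locally l) <->
  forall eps : posreal, zero_infty (fun ab => ball l eps (F ab)).
Proof. exact: filterlim_locally. Qed.

Lemma near_zero_infty_lt (c d : R) : 0 < c -> 
  zero_infty (fun ab : R * R => 0 < fst ab < c /\ d < snd ab).
Proof. by move=> c0; apply: (near_zero_infty _ c d) => // a b. Qed.

Lemma filterlim_is_RInt_gen (V : NormedModule R_AbsRing) (f : R -> V)
    (F : R * R -> V) (l : V) :
  zero_infty (fun ab : R * R => is_RInt f (fst ab) (snd ab) (F ab)) ->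
  filterlim F zero_infty (locally l) ->
  is_RInt_gen f (at_right 0) (Rbar_locally p_infty) l.
Proof.
move=> H1 H2 P HP.
have H3 : zero_infty (fun ab => P (F ab)) := H2 P HP.
have H4 := zero_infty_and _ _ H1 H3.
rewrite /filtermapi; apply: zero_infty_imp H4 => ab [h1 h2].
by exists (F ab).
Qed.

Lemma is_RInt_gen_filterlim (f : R -> R) (l : R) :
  is_RInt_gen f (at_right 0) (Rbar_locally p_infty) l ->
  filterlim (fun ab : R * R => RInt f (fst ab) (snd ab)) zero_infty (locally l).
Proof.
move=> H P HP.
have h : zero_infty (fun ab => exists y, is_RInt f (fst ab) (snd ab) y /\ P y)
  := H P HP.
rewrite /filtermap; apply: zero_infty_imp h => ab [y [h1 h2]].
by rewrite (is_RInt_unique _ _ _ _ h1).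
Qed.

Lemma is_RInt_gen_R_unique (f : R -> R) (l l' : R) :
  is_RInt_gen f (at_right 0) (Rbar_locally p_infty) l ->
  is_RInt_gen f (at_right 0) (Rbar_locally p_infty) l' -> l = l'.
Proof.
move=> H H'.
by rewrite -(is_RInt_gen_unique _ _ H) -(is_RInt_gen_unique _ _ H').
Qed.

(** The lower endpoint tends to 0 from the right, so only positive arguments are integrated over;
    what happens at [l <= 0], where [Rpower] takes default values, is irrelevant. *)
Lemma is_RInt_gen_ext_pos (V : NormedModule R_AbsRing) (f g : R -> V) (l : V) :
  (forall x, 0 < x -> f x = g x) ->
  is_RInt_gen f (at_right 0) (Rbar_locally p_infty) l ->
  is_RInt_gen g (at_right 0) (Rbar_locally p_infty) l.
Proof.
move=> e; apply: is_RInt_gen_ext; apply: (near_zero_infty _ 1 1); first lra.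
move=> x y hx hy z /=; rewrite Rmin_left; last lra.
by move=> [hz _]; apply: e; lra.
Qed.

Lemma Rpower_opp_cvg_infty (s : R) : 0 < s -> forall eps : posreal,
  exists M, 0 < M /\ forall x, M < x -> Rpower x (- s) < eps.
Proof.
move=> s0 eps.
have e0 := cond_pos eps.
(* The threshold solves [M^(-s) = eps]. *)
exists (Rpower eps (- / s)); split; first exact: exp_pos.
move=> x hx.
have x0 : 0 < x by apply: Rlt_trans hx; apply: exp_pos.
rewrite Rpower_Ropp.
rewrite -[X in _ < X]Rinv_inv.
apply: Rinv_lt_contravar.
  by apply: Rmult_lt_0_compat; [apply: Rinv_0_lt_compat | apply: exp_pos].
have -> : / eps = Rpower (Rpower eps (- / s)) s.
  rewrite Rpower_mult.
  have -> : - / s * s = - 1 by field; lra.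
  by rewrite Rpower_Ropp Rpower_1.
rewrite /Rpower; apply: exp_increasing.
apply: Rmult_lt_compat_l => //.
by apply: ln_increasing => //; apply: exp_pos.
Qed.

Lemma Rpower_cvg_zero (s : R) : 0 < s -> forall eps : posreal,
  exists d, 0 < d /\ forall x, 0 < x < d -> Rpower x s < eps.
Proof.
move=> s0 eps.
have [M [M0 H]] := Rpower_opp_cvg_infty s s0 eps.
exists (/ M); split; first exact: Rinv_0_lt_compat.
move=> x [x0 xM].
have h : M < / x.
  rewrite -[M]Rinv_inv; apply: Rinv_lt_contravar => //.
  by apply: Rmult_lt_0_compat => //; apply: Rinv_0_lt_compat.
have -> : Rpower x s = Rpower (/ x) (- s).
  rewrite /Rpower ln_Rinv //; congr exp; ring.
exact: H.
Qed.

(* With [w = r e^(i phi)], [rot_re] and [rot_im] are the real and imaginary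
   parts of [e^(i theta) l^(-a) w^a / (l + w)] up to the factor [r^a]. *)
Definition rot_den (r phi l : R) : R :=
  (l + r * cos phi) ^ 2 + (r * sin phi) ^ 2.

Definition rot_re (a r theta phi l : R) : R :=
  Rpower l (- a) *
    (cos (a * phi + theta) * (l + r * cos phi) +
     sin (a * phi + theta) * (r * sin phi)) / rot_den r phi l.

Definition rot_im (a r theta phi l : R) : R :=
  Rpower l (- a) *
    (sin (a * phi + theta) * (l + r * cos phi) -
     cos (a * phi + theta) * (r * sin phi)) / rot_den r phi l.

(** With [cos phi] lowered to [k - 1], the difference of the two sides is [(1 - k) (l - r)^2]. A
    single [k] then serves for every angle whose cosine is at least [k - 1]. *)
Lemma rot_den_ge (r phi k l : R) :
  0 < r -> 0 < l -> k <= 1 -> k - 1 <= cos phi ->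
  k * (l ^ 2 + r ^ 2) <= rot_den r phi l.
Proof.
move=> r0 l0 k1 kc.
have e : rot_den r phi l = l ^ 2 + r ^ 2 + 2 * (l * r) * cos phi.
  rewrite /rot_den; have := sin2_cos2 phi; rewrite /Rsqr; nra.
rewrite e; have lr : 0 < l * r by nra.
have : 2 * (l * r) * (k - 1) <= 2 * (l * r) * cos phi.
  apply: Rmult_le_compat_l; lra.
have : 0 <= (1 - k) * (l - r) ^ 2.
  by apply: Rmult_le_pos; [lra | apply: pow2_ge_0].
lra.
Qed.

Lemma cos_gt_m1 (phi : R) : - PI < phi < PI -> - 1 < cos phi.
Proof.
move=> h; have [pp|pn] := Rle_dec 0 phi.
  rewrite -cos_PI; apply: cos_decreasing_1; lra.
rewrite -cos_PI -(cos_neg phi); apply: cos_decreasing_1; lra.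
Qed.

Lemma rot_den_gt0 (r phi l : R) :
  0 < r -> 0 < l -> - PI < phi < PI -> 0 < rot_den r phi l.
Proof.
move=> r0 l0 /cos_gt_m1 c1.
have h1 : Rmin 1 (1 + cos phi) <= 1 by apply: Rmin_l.
have h2 : Rmin 1 (1 + cos phi) - 1 <= cos phi.
  by have := Rmin_r 1 (1 + cos phi); lra.
have h3 : 0 < Rmin 1 (1 + cos phi) by apply: Rmin_glb_lt; lra.
apply: Rlt_le_trans (rot_den_ge _ _ _ _ r0 l0 h1 h2).
by apply: Rmult_lt_0_compat => //; nra.
Qed.

(** With [F = e^(i theta) l^(-a) e^(i a phi) / (l + r e^(i phi))], the product [l F] is a
    holomorphic function of [ln l - i phi]. Hence the derivative of [F] in [phi] is [- i] times the
    derivative of [l F] in [l]; [rot_der] is the real part of both. *)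
Definition rot_der (a r theta phi l : R) : R :=
  Rpower l (- a) *
  ((a * (cos (a * phi + theta) * (r * sin phi)
        - sin (a * phi + theta) * (l + r * cos phi))
    + (sin (a * phi + theta) * (r * cos phi)
       - cos (a * phi + theta) * (r * sin phi))) * rot_den r phi l
   - (cos (a * phi + theta) * (l + r * cos phi) +
      sin (a * phi + theta) * (r * sin phi)) *
     (2 * (l + r * cos phi) * (- (r * sin phi)) +
      2 * (r * sin phi) * (r * cos phi))) / rot_den r phi l ^ 2.

Lemma is_derive_rot_re (a r theta phi l : R) :
  0 < r -> 0 < l -> - PI < phi < PI ->
  is_derive (fun p => rot_re a r theta p l) phi (rot_der a r theta phi l).
Proof.
move=> r0 l0 hp; have := rot_den_gt0 r phi l r0 l0 hp.
rewrite /rot_re /rot_der /rot_den => D0.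
auto_derive; first by move=> /=; lra.
by field; lra.
Qed.

Lemma is_derive_rot_im (a r theta phi l : R) :
  0 < r -> 0 < l -> - PI < phi < PI ->
  is_derive (fun x => x * rot_im a r theta phi x) l (rot_der a r theta phi l).
Proof.
move=> r0 l0 hp; have := rot_den_gt0 r phi l r0 l0 hp.
rewrite /rot_im /rot_der /rot_den /Rpower => D0.
auto_derive; first by repeat split => //=; lra.
by field; split; lra.
Qed.

Lemma continuity_2d_rot_der (a r theta phi l : R) :
  0 < r -> 0 < l -> - PI < phi < PI ->
  continuity_2d_pt (rot_der a r theta) phi l.
Proof.
move=> r0 l0 hp; have D0 := rot_den_gt0 r phi l r0 l0 hp.
have cc (f : R -> R) (g : R -> R -> R) : (forall x, continuity_pt f x) ->
    continuity_2d_pt g phi l -> continuity_2d_pt (fun u v => f (g u v)) phi l.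
  by move=> cf cg; apply: continuity_1d_2d_pt_comp.
have cln : continuity_2d_pt (fun _ v => ln v) phi l.
  apply: (continuity_1d_2d_pt_comp ln (fun _ v => v)).
    by apply/continuity_pt_filterlim; apply: continuous_ln.
  exact: continuity_2d_pt_id2.
rewrite /rot_der /Rpower; rewrite /rot_den in D0 *.
repeat first
  [ exact: continuity_2d_pt_id1 | exact: continuity_2d_pt_id2
  | exact: continuity_2d_pt_const | exact: cln
  | apply: continuity_2d_pt_mult | apply: continuity_2d_pt_plus
  | apply: continuity_2d_pt_minus | apply: continuity_2d_pt_opp
  | apply: (cc cos) => [x|]; [exact: continuity_cos|]
  | apply: (cc sin) => [x|]; [exact: continuity_sin|]
  | apply: (cc exp) => [x|]; [exact/derivable_continuous_pt/derivable_pt_exp|]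
  | apply: continuity_2d_pt_inv => /= ].
have := Rmult_lt_0_compat _ _ D0 D0; rewrite /= in D0 *; nra.
Qed.

Lemma continuous_rot_re (a r theta phi l : R) :
  0 < r -> 0 < l -> - PI < phi < PI -> continuous (rot_re a r theta phi) l.
Proof.
move=> r0 l0 hp; apply: ex_derive_continuous.
have := rot_den_gt0 r phi l r0 l0 hp.
rewrite /rot_re /rot_den /Rpower => D0.
by auto_derive; repeat split => //=; lra.
Qed.

Lemma ex_RInt_rot_re (a r theta phi x y : R) :
  0 < r -> 0 < x -> 0 < y -> - PI < phi < PI ->
  ex_RInt (rot_re a r theta phi) x y.
Proof.
move=> r0 x0 y0 hp; apply: ex_RInt_continuous => z hz.
apply: continuous_rot_re => //; have := Rmin_glb_lt _ _ _ x0 y0; lra.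
Qed.

(** Differentiation under the integral sign produces [rot_der], which is an exact derivative in
    [l]. *)
Lemma is_derive_RInt_rot_re (a r theta phi x y : R) :
  0 < r -> 0 < x -> 0 < y -> - PI < phi < PI ->
  is_derive (fun p => RInt (rot_re a r theta p) x y) phi
    (y * rot_im a r theta phi y - x * rot_im a r theta phi x).
Proof.
move=> r0 x0 y0 hp.
have pos t : Rmin x y <= t <= Rmax x y -> 0 < t.
  have := Rmin_glb_lt _ _ _ x0 y0; lra.
have nb : locally phi (fun p => - PI < p < PI).
  have h : 0 < Rmin (phi + PI) (PI - phi) by apply: Rmin_glb_lt; lra.
  exists (mkposreal _ h) => p.
  rewrite /ball /= /AbsRing_ball /abs /minus /plus /opp /= => /Rabs_def2.
  have := Rmin_l (phi + PI) (PI - phi).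
  have := Rmin_r (phi + PI) (PI - phi); lra.
have <- : RInt (fun t => Derive (fun u => rot_re a r theta u t) phi) x y =
   y * rot_im a r theta phi y - x * rot_im a r theta phi x.
  apply: is_RInt_unique.
  apply: (is_RInt_ext (rot_der a r theta phi)) => [t ht|].
    symmetry; apply: is_derive_unique; apply: is_derive_rot_re => //.
    apply: pos; lra.
  apply: (is_RInt_derive (fun t => t * rot_im a r theta phi t)) => t /pos t0.
    exact: is_derive_rot_im.
  have := continuity_2d_rot_der a r theta phi t r0 t0 hp.
  rewrite continuity_2d_pt_filterlim => H.
  apply: (continuous_comp_2 (fun _ => phi) (fun t => t) (rot_der a r theta)) => //.
    exact: continuous_const.
apply: (is_derive_RInt_param (fun p l => rot_re a r theta p l)).
- case: nb => e He; exists e => p hpp t ht.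
  exists (rot_der a r theta p t); apply: is_derive_rot_re => //; first exact: pos.
  exact: He.
- move=> t ht; have t0 := pos t ht.
  apply: continuity_2d_pt_ext_loc (continuity_2d_rot_der a r theta phi t r0 t0 hp).
  case: nb => e He.
  have h : 0 < Rmin e t by apply: Rmin_glb_lt => //; apply: cond_pos.
  exists (mkposreal _ h) => u v /= hu hv.
  symmetry; apply: is_derive_unique; apply: is_derive_rot_re => //.
    by move: hv => /Rabs_def2; have := Rmin_r e t; lra.
  apply: He; apply: Rlt_le_trans hu _; exact: Rmin_l.
- case: nb => e He; exists e => p hpp; apply: ex_RInt_rot_re => //; exact: He.
Qed.

Lemma rot_im_bound (a r theta phi l k : R) :
  0 < r -> 0 < l -> 0 < k <= 1 -> k - 1 <= cos phi ->
  Rabs (rot_im a r theta phi l) <=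
    Rpower l (- a) * ((l + 2 * r) / (k * (l ^ 2 + r ^ 2))).
Proof.
move=> r0 l0 hk kc.
have D := rot_den_ge r phi k l r0 l0 (proj2 hk) kc.
have d0 : 0 < k * (l ^ 2 + r ^ 2) by apply: Rmult_lt_0_compat; nra.
rewrite /rot_im /Rdiv Rmult_assoc Rabs_mult Rabs_pos_eq; last exact/Rlt_le/exp_pos.
apply: Rmult_le_compat_l; first exact/Rlt_le/exp_pos.
rewrite Rabs_mult (Rabs_pos_eq (/ _)); last by apply/Rlt_le/Rinv_0_lt_compat; lra.
apply: Rmult_le_compat.
- exact: Rabs_pos.
- by apply/Rlt_le/Rinv_0_lt_compat; lra.
- have hs := SIN_bound (a * phi + theta); have hc := COS_bound (a * phi + theta).
  have := SIN_bound phi; have := COS_bound phi.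
  move=> hc' hs'; set s := sin (_ + _) in hs *; set c := cos (_ + _) in hc *.
  set c' := cos phi in hc' *; set s' := sin phi in hs' *.
  have h1 : Rabs (s * (l + r * c')) <= 1 * (l + r).
    rewrite Rabs_mult; apply: Rmult_le_compat; try exact: Rabs_pos.
      by apply: Rabs_le; lra.
    by apply: Rabs_le; split; nra.
  have h2 : Rabs (c * (r * s')) <= 1 * r.
    rewrite Rabs_mult; apply: Rmult_le_compat; try exact: Rabs_pos.
      by apply: Rabs_le; lra.
    by apply: Rabs_le; split; nra.
  have := Rabs_triang (s * (l + r * c')) (- (c * (r * s'))).
  rewrite Rabs_Ropp; rewrite /Rminus; lra.
- by apply: Rinv_le_contravar.
Qed.

(** This bound and the next one make the boundary terms vanish at 0 (as [l^(1 - a)]) and at infinity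
    (as [l^(- a)]), uniformly in the angle as long as [k] is fixed. *)
Lemma rot_im_bound_small (a r theta phi l k : R) :
  0 < r -> 0 < l < 1 -> 0 < k <= 1 -> k - 1 <= cos phi ->
  Rabs (l * rot_im a r theta phi l) <=
    Rpower l (1 - a) * ((1 + 2 * r) / (k * r ^ 2)).
Proof.
move=> r0 [l0 l1] hk kc.
rewrite Rabs_mult (Rabs_pos_eq l); last lra.
apply: Rle_trans (Rmult_le_compat_l _ _ _ _
  (rot_im_bound _ _ _ _ _ k r0 l0 hk kc)) _; first lra.
have -> : Rpower l (1 - a) = l * Rpower l (- a).
  by rewrite /Rminus Rpower_plus Rpower_1.
rewrite Rmult_assoc; apply: Rmult_le_compat_l; first lra.
apply: Rmult_le_compat_l; first exact/Rlt_le/exp_pos.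
have h1 : 0 < k * r ^ 2 by apply: Rmult_lt_0_compat; nra.
apply: Rmult_le_compat; try nra.
  by apply/Rlt_le/Rinv_0_lt_compat; nra.
by apply: Rinv_le_contravar => //; nra.
Qed.

Lemma rot_im_bound_large (a r theta phi l k : R) :
  0 < r -> 1 < l -> 0 < k <= 1 -> k - 1 <= cos phi ->
  Rabs (l * rot_im a r theta phi l) <= Rpower l (- a) * ((1 + 2 * r) / k).
Proof.
move=> r0 l1 hk kc.
have l0 : 0 < l by lra.
rewrite Rabs_mult (Rabs_pos_eq l); last lra.
apply: Rle_trans (Rmult_le_compat_l _ _ _ _
  (rot_im_bound _ _ _ _ _ k r0 l0 hk kc)) _; first lra.
have -> (p q : R) : l * (p * q) = p * (l * q) by ring.
apply: Rmult_le_compat_l; first exact/Rlt_le/exp_pos.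
have h1 : 0 < k * (l ^ 2 + r ^ 2) by apply: Rmult_lt_0_compat; nra.
apply: (Rmult_le_reg_r (k * (l ^ 2 + r ^ 2))) => //.
have -> : l * ((l + 2 * r) / (k * (l ^ 2 + r ^ 2))) * (k * (l ^ 2 + r ^ 2)) =
  l * (l + 2 * r) by field; nra.
have -> : (1 + 2 * r) / k * (k * (l ^ 2 + r ^ 2)) =
  (1 + 2 * r) * (l ^ 2 + r ^ 2) by field; lra.
have : 0 <= r * (l * (l - 1)) by apply: Rmult_le_pos; nra.
have : 0 < r * r ^ 2 by apply: Rmult_lt_0_compat; nra.
nra.
Qed.

(* The derivative in [phi] of the integral over [[x, y]] is a boundary term,
   which vanishes in the limit: rotating the ray does not change the integral. *)
Lemma is_RInt_gen_rot_re (a r theta phi I : R) :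
  0 < a < 1 -> 0 < r -> - PI < phi < PI ->
  is_RInt_gen (fun l => Rpower l (- a) / (l + r))
    (at_right 0) (Rbar_locally p_infty) I ->
  is_RInt_gen (rot_re a r theta phi)
    (at_right 0) (Rbar_locally p_infty) (cos theta * I).
Proof.
move=> ha r0 hp HI.
have H0 : is_RInt_gen (rot_re a r theta 0)
    (at_right 0) (Rbar_locally p_infty) (cos theta * I).
  apply: (is_RInt_gen_ext_pos _ (fun l => scal (cos theta) (Rpower l (- a) / (l + r)))).
    move=> l hl; rewrite /scal /= /mult /= /rot_re /rot_den.
    rewrite Rmult_0_r Rplus_0_l cos_0 sin_0 Rmult_1_r Rmult_0_r.
    field; nra.
  exact: is_RInt_gen_scal HI.
have lim0 := is_RInt_gen_filterlim _ _ H0.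
apply: (filterlim_is_RInt_gen _ _ (fun xy => RInt (rot_re a r theta phi) (fst xy) (snd xy))).
  apply: (near_zero_infty _ 1 1); first lra.
  move=> x y hx hy /=; apply: RInt_correct; apply: ex_RInt_rot_re => //; lra.
apply/zero_infty_locally => eps.
have c1 := cos_gt_m1 phi hp.
(* This [k] is admissible at every angle [p] between 0 and [phi], since [cos phi <= cos p] there;
   the mean value theorem gives no other information on [p]. *)
pose k := Rmin 1 (1 + cos phi).
have k0 : 0 < k by apply: Rmin_glb_lt; lra.
have hk : 0 < k <= 1 by split => //; apply: Rmin_l.
pose C1 := (1 + 2 * r) / (k * r ^ 2).
pose C2 := (1 + 2 * r) / k.
have C1p : 0 < C1.
  by apply: Rdiv_lt_0_compat; [lra | apply: Rmult_lt_0_compat; nra].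
have C2p : 0 < C2 by apply: Rdiv_lt_0_compat; lra.
(* Each boundary term is kept below [eps / 16]; both together, times [|phi| <= PI <= 4], stay below
   [eps / 2]. The other half of [eps] is spent on the convergence at angle 0. *)
have e1p : 0 < eps / (16 * C1).
  by apply: Rdiv_lt_0_compat; [exact: cond_pos | lra].
have e2p : 0 < eps / (16 * C2).
  by apply: Rdiv_lt_0_compat; [exact: cond_pos | lra].
have [|d [d0 Hd]] := Rpower_cvg_zero (1 - a) _ (mkposreal _ e1p); first lra.
have [|M [M0 HM]] := Rpower_opp_cvg_infty a _ (mkposreal _ e2p); first lra.
have e2 : 0 < eps / 2 by have := cond_pos eps; lra.
have near0 := proj1 (zero_infty_locally _ _ _) lim0 (mkposreal _ e2).
have near1 : zero_infty (fun ab : R * R =>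
    (0 < fst ab < Rmin 1 d /\ Rmax 1 M < snd ab)).
  by apply: near_zero_infty_lt; apply: Rmin_glb_lt; lra.
apply: zero_infty_imp (zero_infty_and _ _ near0 near1) => -[x y] /= [hb [hx hy]].
have x1 := Rmin_l 1 d; have x2 := Rmin_r 1 d.
have y1 := Rmax_l 1 M; have y2 := Rmax_r 1 M.
pose dF p := y * rot_im a r theta p y - x * rot_im a r theta p x.
have inpi p : Rmin 0 phi <= p <= Rmax 0 phi -> - PI < p < PI.
  have := Rmin_glb_lt _ _ (- PI) (Ropp_lt_gt_0_contravar _ PI_RGT_0) (proj1 hp).
  have := Rmax_lub_lt _ _ PI PI_RGT_0 (proj2 hp); lra.
have [p h|p h|p [hpp e]] := MVT_gen (fun p => RInt (rot_re a r theta p) x y) 0 phi dF.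
- by apply: is_derive_RInt_rot_re; try lra; apply: inpi; lra.
- have D : ex_derive (fun p => RInt (rot_re a r theta p) x y) p.
    by exists (dF p); apply: is_derive_RInt_rot_re; try lra; apply: inpi; lra.
  apply: derivable_continuous_pt.
  exact: ex_derive_Reals_0.
have cp : cos phi <= cos p.
  have [p0|p0] := Rle_dec 0 phi.
    move: hpp; rewrite Rmin_left // Rmax_right // => hpp.
    by apply: cos_decr_1; lra.
  move: hpp; rewrite Rmin_right ?Rmax_left; try lra; move=> hpp.
  by rewrite -(cos_neg phi) -(cos_neg p); apply: cos_decr_1; lra.
have kc : k - 1 <= cos p by have := Rmin_r 1 (1 + cos phi); rewrite -/k; lra.
have b1 := rot_im_bound_small a r theta p x k r0
  (conj (proj1 hx) (Rlt_le_trans _ _ _ (proj2 hx) x1)) hk kc.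
have b2 := rot_im_bound_large a r theta p y k r0
  (Rle_lt_trans _ _ _ y1 hy) hk kc.
rewrite -/C1 in b1; rewrite -/C2 in b2.
have e1' : Rpower x (1 - a) * C1 < eps / 16.
  have -> : eps / 16 = eps / (16 * C1) * C1 by field; lra.
  by apply: Rmult_lt_compat_r => //; apply: Hd; lra.
have e2' : Rpower y (- a) * C2 < eps / 16.
  have -> : eps / 16 = eps / (16 * C2) * C2 by field; lra.
  by apply: Rmult_lt_compat_r => //; apply: HM; lra.
have b3 : Rabs (dF p * (phi - 0)) < eps / 2.
  rewrite Rabs_mult.
  have t1 : Rabs (dF p) < eps / 8.
    have := Rabs_triang (y * rot_im a r theta p y) (- (x * rot_im a r theta p x)).
    rewrite Rabs_Ropp /dF /Rminus; lra.
  have t2 : Rabs (phi - 0) <= 4 by apply: Rabs_le; have := PI_4; lra.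
  apply: Rle_lt_trans (Rmult_le_compat_l _ _ _ (Rabs_pos _) t2) _; lra.
move: hb; rewrite /ball /= /AbsRing_ball /abs /minus /plus /opp /= => hb.
have -> : RInt (rot_re a r theta phi) x y + - (cos theta * I) =
   (RInt (rot_re a r theta 0) x y + - (cos theta * I)) + dF p * (phi - 0).
  rewrite -e; ring.
apply: Rle_lt_trans (Rabs_triang _ _) _; lra.
Qed.

Lemma zero_infty_map (g : R -> R) (P : R * R -> Prop) :
  filterlim g (at_right 0) (at_right 0) ->
  filterlim g (Rbar_locally p_infty) (Rbar_locally p_infty) ->
  zero_infty P -> zero_infty (fun ab => P (g (fst ab), g (snd ab))).
Proof.
move=> g0 g1 [Q S HQ HS HP].
apply: (Filter_prod _ _ _ (fun x => Q (g x)) (fun y => S (g y))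
  (g0 Q HQ) (g1 S HS)) => x y; exact: HP.
Qed.

Lemma is_RInt_gen_subst (f g dg : R -> R) (I : R) :
  (forall x, 0 < x -> 0 < g x) ->
  (forall x, 0 < x -> continuous f x) ->
  (forall x, 0 < x -> is_derive g x (dg x) /\ continuous dg x) ->
  filterlim g (at_right 0) (at_right 0) ->
  filterlim g (Rbar_locally p_infty) (Rbar_locally p_infty) ->
  is_RInt_gen f (at_right 0) (Rbar_locally p_infty) I ->
  is_RInt_gen (fun x => dg x * f (g x)) (at_right 0) (Rbar_locally p_infty) I.
Proof.
move=> gp fc gd g0 g1 /is_RInt_gen_filterlim H.
apply: (filterlim_is_RInt_gen _ _ (fun ab => RInt f (g (fst ab)) (g (snd ab)))).
  apply: (near_zero_infty _ 1 1); first lra.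
  move=> x y hx hy /=; apply: is_RInt_comp => z; rewrite Rmin_left; try lra; move=> hz.
    by apply: fc; apply: gp; lra.
  by apply: gd; lra.
move=> P HP.
exact: (zero_infty_map g (fun ab => P (RInt f (fst ab) (snd ab))) g0 g1 (H P HP)).
Qed.

Lemma is_RInt_Rpower (s x y : R) : s + 1 <> 0 -> 0 < x <= y ->
  is_RInt (fun l => Rpower l s) x y
    ((Rpower y (s + 1) - Rpower x (s + 1)) / (s + 1)).
Proof.
move=> s1 hxy.
have -> : (Rpower y (s + 1) - Rpower x (s + 1)) / (s + 1) =
  minus (Rpower y (s + 1) / (s + 1)) (Rpower x (s + 1) / (s + 1)).
  by rewrite /minus /plus /opp /=; field.
apply: (is_RInt_derive (fun l => Rpower l (s + 1) / (s + 1))) => l;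
  rewrite Rmin_left; try lra; move=> hl.
  rewrite /Rpower; auto_derive; first lra.
  have -> : (s + 1) * ln l = s * ln l + ln l by ring.
  rewrite exp_plus exp_ln; try lra; field; lra.
apply: ex_derive_continuous; rewrite /Rpower; auto_derive; lra.
Qed.

(** * Existence and value of the integral of [l^(-a) / (l + 1)] *)

Lemma beta_kernel_ge0 (a l : R) : 0 < l -> 0 <= Rpower l (- a) / (l + 1).
Proof.
move=> l0; apply: Rmult_le_pos; first exact/Rlt_le/exp_pos.
by apply/Rlt_le/Rinv_0_lt_compat; lra.
Qed.

Lemma continuous_beta_kernel (a l : R) :
  0 < l -> continuous (fun l => Rpower l (- a) / (l + 1)) l.
Proof.
by move=> l0; apply: ex_derive_continuous; rewrite /Rpower; auto_derive; lra.
Qed.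

Lemma ex_RInt_beta_kernel (a x y : R) :
  0 < x -> 0 < y -> ex_RInt (fun l => Rpower l (- a) / (l + 1)) x y.
Proof.
move=> x0 y0; apply: ex_RInt_continuous => z hz.
apply: continuous_beta_kernel; have := Rmin_glb_lt _ _ _ x0 y0; lra.
Qed.

Lemma RInt_beta_kernel_mono (a x x' y y' : R) : 0 < x' <= x -> x <= y <= y' ->
  RInt (fun l => Rpower l (- a) / (l + 1)) x y <=
  RInt (fun l => Rpower l (- a) / (l + 1)) x' y'.
Proof.
move=> hx hy.
have ex u v : 0 < u -> 0 < v -> ex_RInt (fun l => Rpower l (- a) / (l + 1)) u v.
  exact: ex_RInt_beta_kernel.
rewrite -(RInt_Chasles _ x' x y'); try (apply: ex; lra).
rewrite -(RInt_Chasles _ x y y'); try (apply: ex; lra).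
have p u v : 0 < u <= v -> 0 <= RInt (fun l => Rpower l (- a) / (l + 1)) u v.
  move=> huv; apply: RInt_ge_0; [lra | apply: ex; lra |].
  by move=> l hl; apply: beta_kernel_ge0; lra.
have := p x' x; have := p y y'; rewrite /plus /=; lra.
Qed.

(** Split at 1, with [1 / (l + 1) <= 1] on the left and [1 / (l + 1) <= 1 / l] on the right. *)
Lemma RInt_beta_kernel_le (a x y : R) : 0 < a < 1 -> 0 < x <= 1 -> 1 <= y ->
  RInt (fun l => Rpower l (- a) / (l + 1)) x y <= / (1 - a) + / a.
Proof.
move=> ha hx hy.
have ex u v : 0 < u -> 0 < v -> ex_RInt (fun l => Rpower l (- a) / (l + 1)) u v.
  exact: ex_RInt_beta_kernel.
rewrite -(RInt_Chasles _ x 1 y); try (apply: ex; lra).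
rewrite /plus /=; apply: Rplus_le_compat.
  have h : is_RInt (fun l => Rpower l (- a)) x 1
    ((Rpower 1 (- a + 1) - Rpower x (- a + 1)) / (- a + 1)).
    by apply: is_RInt_Rpower; lra.
  apply: Rle_trans (RInt_le _ _ _ _ _ _ (ex_intro _ _ h) _) _; [lra | apply: ex; lra | |].
    move=> l hl; have p := exp_pos (- a * ln l); rewrite -/(Rpower _ _) in p.
    rewrite -[X in _ <= X]Rdiv_1_r; apply: Rmult_le_compat_l; first lra.
    by apply: Rinv_le_contravar; lra.
  rewrite (is_RInt_unique _ _ _ _ h) /Rpower ln_1 Rmult_0_r exp_0.
  have -> : / (1 - a) = 1 / (- a + 1) by field; lra.
  apply: Rmult_le_compat_r; first by apply/Rlt_le/Rinv_0_lt_compat; lra.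
  have := exp_pos ((- a + 1) * ln x); lra.
have h : is_RInt (fun l => Rpower l (- a - 1)) 1 y
  ((Rpower y (- a - 1 + 1) - Rpower 1 (- a - 1 + 1)) / (- a - 1 + 1)).
  by apply: is_RInt_Rpower; lra.
apply: Rle_trans (RInt_le _ _ _ _ _ _ (ex_intro _ _ h) _) _; [lra | apply: ex; lra | |].
  move=> l hl; rewrite /Rminus Rpower_plus (Rpower_Ropp l 1) Rpower_1; last lra.
  apply: Rmult_le_compat_l; first exact/Rlt_le/exp_pos.
  by apply: Rinv_le_contravar; lra.
rewrite (is_RInt_unique _ _ _ _ h) /Rpower ln_1 Rmult_0_r exp_0.
have -> : (exp ((- a - 1 + 1) * ln y) - 1) / (- a - 1 + 1) =
  / a - exp ((- a - 1 + 1) * ln y) / a by field; lra.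
have : 0 < exp ((- a - 1 + 1) * ln y) / a.
  by apply: Rdiv_lt_0_compat; [apply: exp_pos | lra].
lra.
Qed.

(** On (0, 1) the integrand is at least [l^(-a) - 1], because [l^(1 - a) <= 1]. *)
Lemma RInt_beta_kernel_ge (a x : R) : 0 < a < 1 -> 0 < x <= 1 ->
  (1 - Rpower x (1 - a)) / (1 - a) - 1 <=
  RInt (fun l => Rpower l (- a) / (l + 1)) x 1.
Proof.
move=> ha hx.
have h : is_RInt (fun l => Rpower l (- a)) x 1
  ((Rpower 1 (- a + 1) - Rpower x (- a + 1)) / (- a + 1)).
  by apply: is_RInt_Rpower; lra.
have h1 : is_RInt (fun l => Rpower l (- a) - 1) x 1
  ((Rpower 1 (- a + 1) - Rpower x (- a + 1)) / (- a + 1) - (1 - x) * 1).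
  apply: (is_RInt_minus (V := R_NormedModule)) => //.
  exact: (is_RInt_const (V := R_NormedModule)).
apply: Rle_trans (RInt_le _ _ _ _ _ (ex_intro _ _ h1) _ _); first last.
- move=> l hl.
  have p : Rpower l (- a) * l <= 1.
    rewrite -{2}(Rpower_1 l); last lra.
    rewrite -Rpower_plus /Rpower -[X in _ <= X]exp_0.
    have ln0 : ln l < 0 by rewrite -ln_1; apply: ln_increasing; lra.
    apply/Rlt_le/exp_increasing; nra.
  apply: (Rmult_le_reg_r (l + 1)); first lra.
  have -> : Rpower l (- a) / (l + 1) * (l + 1) = Rpower l (- a) by field; lra.
  nra.
- by apply: ex_RInt_beta_kernel; lra.
- lra.
rewrite (is_RInt_unique _ _ _ _ h1) (Rplus_comm (- a)) -/(Rminus 1 a).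
rewrite {2}/Rpower ln_1 Rmult_0_r exp_0; lra.
Qed.

(** The integrals over [[x, y]] increase with the interval and are bounded, so their supremum is the
    limit. The two estimates isolate the pole [1 / (1 - a)] of the value at [a = 1], up to a bounded
    error. *)
Lemma beta_integral_ex (a : R) : 0 < a < 1 ->
  exists I, [/\ is_RInt_gen (fun l => Rpower l (- a) / (l + 1))
                  (at_right 0) (Rbar_locally p_infty) I,
                I <= / (1 - a) + / a & / (1 - a) - 1 <= I].
Proof.
move=> ha.
pose k l := Rpower l (- a) / (l + 1).
pose E v := exists x y, [/\ 0 < x <= 1, 1 <= y & v = RInt k x y].
have [I [ub lub]] : {I | is_lub E I}.
  apply: completeness.
    exists (/ (1 - a) + / a) => v [x [y [hx hy ->]]].
    exact: RInt_beta_kernel_le.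
  by exists (RInt k 1 1), 1, 1; split => //; lra.
exists I; split.
- apply: (filterlim_is_RInt_gen _ _ (fun xy => RInt k (fst xy) (snd xy))).
    apply: (near_zero_infty _ 1 1); first lra.
    move=> x y hx hy /=; apply: RInt_correct; apply: ex_RInt_beta_kernel; lra.
  apply/zero_infty_locally => eps.
  have [x [y [hx hy lt]]] : exists x y, [/\ 0 < x <= 1, 1 <= y & I - eps < RInt k x y].
    apply: Classical_Prop.NNPP => H.
    have : I <= I - eps.
      apply: lub => v [x [y [hx hy ->]]].
      by apply: Rnot_lt_le => lt; apply: H; exists x, y.
    have := cond_pos eps; lra.
  apply: zero_infty_imp (near_zero_infty_lt x y (proj1 hx)) => -[x' y'] /= [hx' hy'].
  have h1 : RInt k x y <= RInt k x' y' by apply: RInt_beta_kernel_mono; lra.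
  have h2 : RInt k x' y' <= I by apply: ub; exists x', y'; split => //; lra.
  rewrite /ball /= /AbsRing_ball /abs /minus /plus /opp /=.
  by apply: Rabs_def1; have := cond_pos eps; lra.
- by apply: lub => v [x [y [hx hy ->]]]; apply: RInt_beta_kernel_le.
apply: Rnot_lt_le => lt.
(* If the lower bound failed, an [x] with [x^(1 - a) / (1 - a)] smaller than the gap would give an
   integral over [[x, 1]] exceeding the supremum. *)
have e0 : 0 < (/ (1 - a) - 1 - I) * (1 - a) by apply: Rmult_lt_0_compat; lra.
have [|d [d0 Hd]] := Rpower_cvg_zero (1 - a) _ (mkposreal _ e0); first lra.
have m0 : 0 < Rmin 1 (d / 2) by apply: Rmin_glb_lt; lra.
have m1 := Rmin_l 1 (d / 2); have m2 := Rmin_r 1 (d / 2).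
set x := Rmin 1 (d / 2) in m0 m1 m2.
have h : RInt k x 1 <= I by apply: ub; exists x, 1; split => //; lra.
have h' := RInt_beta_kernel_ge a x ha (conj m0 m1).
have := Hd x; rewrite /= => h''.
have lt2 : Rpower x (1 - a) / (1 - a) < / (1 - a) - 1 - I.
  apply: (Rmult_lt_reg_r (1 - a)); first lra.
  have -> : Rpower x (1 - a) / (1 - a) * (1 - a) = Rpower x (1 - a) by field; lra.
  apply: h''; lra.
have : (1 - Rpower x (1 - a)) / (1 - a) = / (1 - a) - Rpower x (1 - a) / (1 - a).
  by field; lra.
rewrite -/k in h'; lra.
Qed.

(* Rotation to [phi = PI / 2] gives the integral of [l^(-a) / (l^2 + 1)], which
   the substitution [l^2 = s] turns into the one with exponent [(1 + a) / 2]. *)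
Lemma beta_integral_duplication (a I J : R) : 0 < a < 1 ->
  is_RInt_gen (fun l => Rpower l (- a) / (l + 1))
    (at_right 0) (Rbar_locally p_infty) I ->
  is_RInt_gen (fun l => Rpower l (- ((1 + a) / 2)) / (l + 1))
    (at_right 0) (Rbar_locally p_infty) J ->
  J = 2 * sin (a * PI / 2) * I.
Proof.
move=> ha HI HJ.
have pi0 := PI_RGT_0.
have h1 : is_RInt_gen (fun l => 2 * l * (Rpower (l ^ 2) (- ((1 + a) / 2)) / (l ^ 2 + 1)))
    (at_right 0) (Rbar_locally p_infty) J.
  apply: (is_RInt_gen_subst (fun l => Rpower l (- ((1 + a) / 2)) / (l + 1))
    (fun l => l ^ 2) (fun l => 2 * l)) => //.
  - by move=> x x0; nra.
  - by move=> x x0; apply: continuous_beta_kernel.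
  - move=> x x0; split; first by auto_derive => //; ring.
    by apply: ex_derive_continuous; auto_derive.
  - move=> P [e He]; exists (mkposreal _ (Rmin_glb_lt 1 e 0 Rlt_0_1 (cond_pos e))) => x.
    rewrite /ball /= /AbsRing_ball /abs /minus /plus /opp /= => /Rabs_def2 [hx _] x0.
    have := Rmin_l 1 e; have := Rmin_r 1 e => m1 m2.
    apply: He; last nra.
    rewrite /ball /= /AbsRing_ball /abs /minus /plus /opp /=; apply: Rabs_def1; nra.
  - move=> P [M HM]; exists (Rmax 1 M) => x hx; apply: HM.
    have := Rmax_l 1 M; have := Rmax_r 1 M; nra.
(* This [theta] makes [a phi + theta = - PI / 2], so that [rot_re] is exactly
   [- l^(-a) / (l^2 + 1)]; the factor - 2 below restores the sign and the 2 of [d(l^2) = 2 l dl]. *)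
have h2 := is_RInt_gen_rot_re a 1 (- (a * (PI / 2)) - PI / 2) (PI / 2) I ha Rlt_0_1.
have {}h2 := h2 (conj (ltac:(lra) : - PI < PI / 2) (ltac:(lra) : PI / 2 < PI)) HI.
pose proof (is_RInt_gen_scal _ (-2) _ h2) as h3.
have -> : 2 * sin (a * PI / 2) * I = scal (-2) (cos (- (a * (PI / 2)) - PI / 2) * I).
  have -> : - (a * (PI / 2)) - PI / 2 = - (PI / 2 + a * PI / 2) by field.
  rewrite cos_neg cos_plus cos_PI2 sin_PI2 /scal /= /mult /=; ring.
apply: is_RInt_gen_R_unique h1 _.
apply: is_RInt_gen_ext_pos h3 => l hl; rewrite /scal /= /mult /= /rot_re /rot_den.
have -> : a * (PI / 2) + (- (a * (PI / 2)) - PI / 2) = - (PI / 2) by ring.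
rewrite cos_neg sin_neg cos_PI2 sin_PI2.
have -> : Rpower (l * (l * 1)) (- ((1 + a) / 2)) = Rpower l (- a) / l.
  have e : / l = exp (- ln l) by rewrite exp_Ropp exp_ln.
  rewrite [RHS]/Rdiv e /Rpower -exp_plus; congr exp.
  rewrite Rmult_1_r ln_mult; try lra; field.
field; split; nra.
Qed.

(* [sin (PI a) I(a)] is invariant under [a -> (1 + a) / 2], and it tends to
   [PI] as [a] tends to [1]. *)
Lemma beta_integral (a : R) : 0 < a < 1 ->
  is_RInt_gen (fun l => Rpower l (- a) / (l + 1))
    (at_right 0) (Rbar_locally p_infty) (PI / sin (a * PI)).
Proof.
move=> ha; have pi0 := PI_RGT_0.
have [I [HI _ _]] := beta_integral_ex a ha.
suff e : I * sin (a * PI) = PI.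
  have s0 : 0 < sin (a * PI) by apply: sin_gt_0; nra.
  have -> // : PI / sin (a * PI) = I.
  by rewrite -{1}e; field; lra.
(* [1 - d n] is the n-th iterate of [a -> (1 + a) / 2], a map that halves the distance to 1. *)
pose d (n : nat) := (1 - a) * (/ 2) ^ n.
have dp n : 0 < d n by apply: Rmult_lt_0_compat; [lra | apply: pow_lt; lra].
have d1 n : d n <= 1 - a.
  rewrite -[X in _ <= X]Rmult_1_r; apply: Rmult_le_compat_l; first lra.
  have <- : (1) ^ n = 1 by apply: pow1.
  by apply: pow_incr; lra.
have dS n : d n.+1 = d n / 2 by rewrite /d /=; field.
have inv n : exists In, is_RInt_gen (fun l => Rpower l (- (1 - d n)) / (l + 1))
    (at_right 0) (Rbar_locally p_infty) In /\
    In * sin ((1 - d n) * PI) = I * sin (a * PI).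
  elim: n => [|n [In [H1 H2]]].
    by exists I; have -> : 1 - d 0%N = a by rewrite /d /=; ring.
  have [|J [HJ _ _]] := beta_integral_ex (1 - d n.+1).
    by have := dp n.+1; have := d1 n.+1; lra.
  exists J; split => //.
  have e : 1 - d n.+1 = (1 + (1 - d n)) / 2 by rewrite dS; field.
  have hn : 0 < 1 - d n < 1 by have := dp n; have := d1 n; lra.
  rewrite e in HJ.
  rewrite (beta_integral_duplication (1 - d n) In J hn H1 HJ) -H2 e.
  set u := (1 - d n) * PI / 2.
  have -> : (1 + (1 - d n)) / 2 * PI = PI / 2 + u by rewrite /u; field.
  have -> : (1 - d n) * PI = 2 * u by rewrite /u; field.
  rewrite sin_plus sin_2a cos_PI2 sin_PI2.
  ring.
(* The estimates of [beta_integral_ex] give [|In - 1 / d n| <= 1 + 1 / a] uniformly in [n], and the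
   factor [sin (d n PI) <= d n PI] makes the error vanish. *)
have bound n : Rabs (I * sin (a * PI) - sin (d n * PI) / d n) <=
    (1 + / a) * (d n * PI).
  have [In [H1 <-]] := inv n.
  have hn : 0 < 1 - d n < 1 by have := dp n; have := d1 n; lra.
  have [In' [H1' U L]] := beta_integral_ex (1 - d n) hn.
  rewrite -(is_RInt_gen_R_unique _ _ _ H1 H1') in U L.
  have -> : (1 - d n) * PI = PI - d n * PI by ring.
  rewrite sin_PI_x.
  have -> : In * sin (d n * PI) - sin (d n * PI) / d n =
    (In - / d n) * sin (d n * PI) by rewrite /Rdiv; ring.
  have -> : / d n = / (1 - (1 - d n)) by congr Rinv; ring.
  have dpi : 0 < d n * PI by apply: Rmult_lt_0_compat.
  have hs : 0 <= sin (d n * PI) <= d n * PI.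
    split; last exact/Rlt_le/sin_lt_x.
    by apply: sin_ge_0; have := d1 n; nra.
  rewrite Rabs_mult; apply: Rmult_le_compat; try exact: Rabs_pos.
    have : / (1 - d n) <= / a by apply: Rinv_le_contravar; have := d1 n; lra.
    have : 0 < / a by apply: Rinv_0_lt_compat; lra.
    by move=> ? ?; apply: Rabs_le; lra.
  by apply: Rabs_le; lra.
apply: Rminus_diag_uniq; apply: Rabs_eq_0; apply: Rle_antisym; last exact: Rabs_pos.
apply: Rnot_lt_le => lt; set g := Rabs _ in lt.
have ia : 0 < / a by apply: Rinv_0_lt_compat; lra.
have e1 : 0 < g / (2 * PI) by apply: Rdiv_lt_0_compat; lra.
have [dl Hdl] := derivable_pt_lim_sin 0 _ e1.
have e2 : 0 < (1 + / a) * PI by apply: Rmult_lt_0_compat; lra.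
(* The first entry brings [sin (d N PI) / d N] within [g / 2] of [PI], the second brings the error
   of [bound] below [g / 2]; together they contradict the size [g] of the discrepancy. *)
pose m := Rmin (dl / PI) (g / (2 * ((1 + / a) * PI))).
have m0 : 0 < m.
  by apply: Rmin_glb_lt; apply: Rdiv_lt_0_compat => //; try lra; apply: cond_pos.
have [|N HN] := pow_lt_1_zero (/ 2) _ m m0; first by rewrite Rabs_pos_eq; lra.
have {}HN := HN N (le_n _).
rewrite Rabs_pos_eq in HN; last by apply: pow_le; lra.
have dm : d N < m.
  apply: Rle_lt_trans HN; rewrite /d -[X in _ <= X]Rmult_1_l.
  by apply: Rmult_le_compat_r; [apply: pow_le; lra | lra].
have d0 := dp N.
have dpi : 0 < d N * PI by apply: Rmult_lt_0_compat.
have h1 : d N * PI < dl.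
  have -> : (dl : R) = dl / PI * PI by field; lra.
  apply: Rmult_lt_compat_r => //; apply: Rlt_le_trans dm _; exact: Rmin_l.
have h2 : (1 + / a) * (d N * PI) < g / 2.
  have -> : g / 2 = g / (2 * ((1 + / a) * PI)) * ((1 + / a) * PI) by field; nra.
  have -> : (1 + / a) * (d N * PI) = d N * ((1 + / a) * PI) by ring.
  apply: Rmult_lt_compat_r => //; apply: Rlt_le_trans dm _; exact: Rmin_r.
have {}Hdl := Hdl (d N * PI) (Rgt_not_eq _ _ dpi).
rewrite Rabs_pos_eq in Hdl; last lra.
have {}Hdl := Hdl h1.
rewrite Rplus_0_l sin_0 cos_0 in Hdl.
have h3 : Rabs (sin (d N * PI) / d N - PI) < g / 2.
  have -> : sin (d N * PI) / d N - PI = ((sin (d N * PI) - 0) / (d N * PI) - 1) * PI.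
    by field; lra.
  rewrite Rabs_mult (Rabs_pos_eq PI); last lra.
  have -> : g / 2 = g / (2 * PI) * PI by field; lra.
  exact: Rmult_lt_compat_r.
have := Rabs_triang (I * sin (a * PI) - sin (d N * PI) / d N)
  (sin (d N * PI) / d N - PI).
have -> : I * sin (a * PI) - sin (d N * PI) / d N + (sin (d N * PI) / d N - PI) =
  I * sin (a * PI) - PI by ring.
have := bound N; rewrite -/g; lra.
Qed.

Lemma beta_integral_scaled (a r : R) : 0 < a < 1 -> 0 < r ->
  is_RInt_gen (fun l => Rpower l (- a) / (l + r))
    (at_right 0) (Rbar_locally p_infty) (Rpower r (- a) * (PI / sin (a * PI))).
Proof.
move=> ha r0; have ir : 0 < / r by apply: Rinv_0_lt_compat.
have h : is_RInt_gen (fun l => / r * (Rpower (l / r) (- a) / (l / r + 1)))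
    (at_right 0) (Rbar_locally p_infty) (PI / sin (a * PI)).
  apply: (is_RInt_gen_subst (fun l => Rpower l (- a) / (l + 1))
    (fun l => l / r) (fun l => / r)).
  - by move=> x x0; apply: Rdiv_lt_0_compat.
  - by move=> x x0; apply: continuous_beta_kernel.
  - move=> x x0; split; first by auto_derive => //; field; lra.
    exact: continuous_const.
  - move=> P [e He]; have e0 : 0 < e * r by apply: Rmult_lt_0_compat => //; apply: cond_pos.
    exists (mkposreal _ e0) => x.
    rewrite /ball /= /AbsRing_ball /abs /minus /plus /opp /= => /Rabs_def2 [hx _] x0.
    apply: He; last by apply: Rdiv_lt_0_compat.
    rewrite /ball /= /AbsRing_ball /abs /minus /plus /opp /=.
    have := Rdiv_lt_0_compat _ _ x0 r0.
    have : x / r < e by apply: (Rmult_lt_reg_r r) => //; rewrite /Rdiv Rmult_assoc Rinv_l; lra.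
    by have := cond_pos e => ? ? ?; apply: Rabs_def1; lra.
  - move=> P [M HM]; exists (M * r) => x hx; apply: HM.
    by apply: (Rmult_lt_reg_r r) => //; rewrite /Rdiv Rmult_assoc Rinv_l; lra.
  - exact: beta_integral.
pose proof (is_RInt_gen_scal _ (Rpower r (- a)) _ h) as h'.
apply: is_RInt_gen_ext_pos h' => l l0; rewrite /scal /= /mult /=.
have -> : Rpower (l / r) (- a) = Rpower l (- a) / Rpower r (- a).
  rewrite /Rpower /Rdiv -exp_Ropp -exp_plus ln_mult // ln_Rinv //; congr exp; ring.
have := exp_pos (- a * ln r); rewrite -/(Rpower _ _).
by move=> ?; field; repeat split; lra.
Qed.

Local Notation C_over_R := C_R_NormedModule.

Lemma is_RInt_gen_pair (f : R -> C) (x y : R) :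
  is_RInt_gen (fun t => fst (f t)) (at_right 0) (Rbar_locally p_infty) x ->
  is_RInt_gen (fun t => snd (f t)) (at_right 0) (Rbar_locally p_infty) y ->
  is_RInt_gen (V := C_over_R) f (at_right 0) (Rbar_locally p_infty) (x, y).
Proof.
move=> H1 H2 P [e He].
have e1 := H1 _ (locally_ball x e); have e2 := H2 _ (locally_ball y e).
apply: zero_infty_imp (zero_infty_and _ _ e1 e2) => ab [[u [hu bu]] [v [hv bv]]].
by exists (u, v); split; [apply: is_RInt_fct_extend_pair | apply: He; split].
Qed.

(** The choice [theta = - a phi] cancels the factor [e^(i a phi)] and gives the real part; a further
    [- PI / 2] multiplies by [- i] and brings the imaginary part into the real one. The value is
    [PI / sin (a PI)] times the principal power [c^(-a)] of [c = r e^(i phi)]. *)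
Lemma stieltjes_integral (a r phi : R) :
  0 < a < 1 -> 0 < r -> - PI < phi < PI ->
  is_RInt_gen (V := C_over_R)
    (fun l => Cmult (RtoC (Rpower l (- a))) (Cinv (Cplus (RtoC l) (polar r phi))))
    (at_right 0) (Rbar_locally p_infty)
    (Cmult (RtoC (PI / sin (a * PI))) (polar (Rpower r (- a)) (- (a * phi)))).
Proof.
move=> ha r0 hp.
have B := beta_integral_scaled a r ha r0.
have Hre := is_RInt_gen_rot_re a r (- (a * phi)) phi _ ha r0 hp B.
have Him := is_RInt_gen_rot_re a r (- (a * phi) - PI / 2) phi _ ha r0 hp B.
have -> : Cmult (RtoC (PI / sin (a * PI))) (polar (Rpower r (- a)) (- (a * phi))) =
    (cos (- (a * phi)) * (Rpower r (- a) * (PI / sin (a * PI))),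
     cos (- (a * phi) - PI / 2) * (Rpower r (- a) * (PI / sin (a * PI)))).
  have -> : - (a * phi) - PI / 2 = - (PI / 2 - - (a * phi)) by ring.
  by rewrite (cos_neg (PI / 2 - _)) cos_shift /Cmult /RtoC /polar /=; congr pair; ring.
apply: is_RInt_gen_pair.
  apply: is_RInt_gen_ext_pos Hre => l l0; rewrite /rot_re.
  have := rot_den_gt0 r phi l r0 l0 hp; rewrite /rot_den => D.
  have -> : a * phi + - (a * phi) = 0 by ring.
  rewrite cos_0 sin_0 /polar /Cinv /Cplus /Cmult /RtoC /=; field; rewrite /= in D.
  by nra.
apply: is_RInt_gen_ext_pos Him => l l0; rewrite /rot_re.
have := rot_den_gt0 r phi l r0 l0 hp; rewrite /rot_den => D.
have -> : a * phi + (- (a * phi) - PI / 2) = - (PI / 2) by ring.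
rewrite cos_neg sin_neg cos_PI2 sin_PI2.
rewrite /polar /Cinv /Cplus /Cmult /RtoC /=; field; rewrite /= in D.
by nra.
Qed.

(** * Linear maps and integrals *)

Section RiemannSumMorphism.
Variables (V W : ModuleSpace R_Ring) (phi : V -> W).
Hypothesis phiD : forall x y, phi (plus x y) = plus (phi x) (phi y).
Hypothesis phiZ : forall (k : R_Ring) x, phi (scal k x) = scal k (phi x).

Lemma morphism_zero : phi zero = zero.
Proof.
have e : zero = scal (zero : R_Ring) zero :> V by rewrite scal_zero_l.
by rewrite e phiZ scal_zero_l.
Qed.

(** Stated for bare modules: the functions ['I_n -> X] carry the norm of Y only as a relation, so
    convergence is handled apart from the algebra of the sums. *)
Lemma Riemann_sum_morphism (f : R -> V) ptd :
  phi (Riemann_sum f ptd) = Riemann_sum (fun t => phi (f t)) ptd.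
Proof.
move: ptd; apply: SF_cons_ind => [x0|h s IH]; first exact: morphism_zero.
by rewrite !Riemann_sum_cons phiD phiZ IH.
Qed.

End RiemannSumMorphism.

Section LinearIntegral.
Variables (V W : NormedModule R_AbsRing) (phi : V -> W).
Hypothesis lin : is_linear phi.

Lemma is_RInt_linear (f : R -> V) (a b : R) (l : V) :
  is_RInt f a b l -> is_RInt (fun t => phi (f t)) a b (phi l).
Proof.
move=> H.
have e ptd : scal (sign (b - a)) (Riemann_sum (fun t => phi (f t)) ptd) =
    phi (scal (sign (b - a)) (Riemann_sum f ptd)).
  rewrite -(Riemann_sum_morphism _ _ phi) ?linear_scal //.
    exact: linear_plus.
  exact: linear_scal.
apply: (filterlim_ext _ _ (fun ptd => esym (e ptd))).
apply: (filterlim_comp _ _ _ _ _ _ _ _ H).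
exact: linear_cont.
Qed.

Lemma is_RInt_gen_linear (f : R -> V) (l : V) :
  is_RInt_gen f (at_right 0) (Rbar_locally p_infty) l ->
  is_RInt_gen (fun t => phi (f t)) (at_right 0) (Rbar_locally p_infty) (phi l).
Proof.
move=> H P HP.
have c := linear_cont phi l lin P HP.
apply: zero_infty_imp (H _ c) => ab [y [h1 h2]].
by exists (phi y); split => //; apply: is_RInt_linear.
Qed.

End LinearIntegral.

Lemma norm_C_over_R (c : C) : norm (c : C_over_R) = Cmod c.
Proof.
change (sqrt (Rabs (fst c) ^ 2 + Rabs (snd c) ^ 2) = Cmod c).
by rewrite !pow2_abs.
Qed.

Lemma C_over_R_scal (k : R) (c : C) :
  scal (k : R_Ring) (c : C_over_R) = Cmult (RtoC k) c.
Proof.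
case: c => x y; rewrite /Cmult /RtoC /= /scal /= /prod_scal /scal /= /mult /=.
by congr pair; ring.
Qed.

(** * Inner product and Cauchy-Schwarz inequality *)

Section Hilbert.
Variable X : HilbertSpace.
Implicit Types (x y e : X) (c : C).

Lemma inner_plus_r x y z : inner x (plus y z) = Cplus (inner x y) (inner x z).
Proof. by rewrite inner_conj inner_plus_l Cplus_conj -!inner_conj. Qed.

Lemma inner_scal_r c x y : inner x (scal c y) = Cmult (Cconj c) (inner x y).
Proof. by rewrite inner_conj inner_scal_l Cmult_conj -!inner_conj. Qed.

Lemma inner_zero_l y : inner zero y = RtoC 0 :> C.
Proof.
have -> : (zero : X) = scal (zero : C_Ring) (zero : X) by rewrite scal_zero_l.
by rewrite inner_scal_l; apply: Cmult_0_l.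
Qed.

Lemma inner_opp_l x y : inner (opp x) y = Copp (inner x y).
Proof.
have h : Cplus (inner x y) (inner (opp x) y) = RtoC 0.
  by rewrite -inner_plus_l plus_opp_r inner_zero_l.
by rewrite -(Cplus_0_r (Copp _)) -h; ring.
Qed.

Lemma inner_minus_l x y z : inner (minus x y) z = Cminus (inner x z) (inner y z).
Proof. by rewrite /minus inner_plus_l inner_opp_l. Qed.

Lemma inner_opp_r x y : inner x (opp y) = Copp (inner x y).
Proof. by rewrite inner_conj inner_opp_l Copp_conj -inner_conj. Qed.

Lemma inner_minus_r x y z : inner x (minus y z) = Cminus (inner x y) (inner x z).
Proof. by rewrite /minus inner_plus_r inner_opp_r. Qed.

Lemma inner_self_eq0 x : inner x x = RtoC 0 -> x = zero.
Proof.
rewrite inner_norm => /(f_equal Re) /= h; apply: norm_eq_zero.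
have := norm_ge_0 x; nra.
Qed.

Lemma Cauchy_Schwarz x y : Cmod (inner x y) <= norm x * norm y.
Proof.
have nx := norm_ge_0 x; have ny := norm_ge_0 y.
have [y0|y0] := Req_dec (norm y) 0.
  rewrite (norm_eq_zero _ y0) inner_conj inner_zero_l Cmod_conj Cmod_0.
  by apply: Rmult_le_pos => //; apply: norm_ge_0.
pose c := inner x y.
(* [z] is [|y|^2] times the component of [x] orthogonal to [y]; the inequality is [0 <= <z, z>]. *)
pose z := minus (scal (RtoC (norm y ^ 2) : C_Ring) x) (scal (c : C_Ring) y).
have h : inner z z = RtoC (norm y ^ 2 * (norm y ^ 2 * norm x ^ 2 - Cmod c ^ 2)).
  rewrite /z !inner_minus_l !inner_minus_r !inner_scal_l !inner_scal_r.
  rewrite !inner_norm (inner_conj x y) -/c RtoC_mult RtoC_minus Cmod2_conj RtoC_mult.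
  have -> : Cconj (RtoC (norm y ^ 2)) = RtoC (norm y ^ 2).
    by rewrite /Cconj /RtoC /= Ropp_0.
  ring.
have := f_equal Re h; rewrite inner_norm /= => h'.
have n2 : 0 < norm y * (norm y * 1) by nra.
have p : 0 <= norm z * (norm z * 1) by have := norm_ge_0 z; nra.
have q : Cmod c ^ 2 <= (norm x * norm y) ^ 2.
  by apply: (Rmult_le_reg_l _ _ _ n2); move: h' p; rewrite /=; nra.
apply: Rsqr_incr_0_var; last exact: Rmult_le_pos.
by rewrite !Rsqr_pow2.
Qed.

End Hilbert.

(** * Completeness of the eigenvectors *)

Lemma inner_ext (X : HilbertSpace) (x y : X) :
  (forall w, inner x w = inner y w) -> x = y.
Proof.
move=> h; have e : minus x y = zero.
  by apply: inner_self_eq0; rewrite inner_minus_l h; ring.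
have -> : x = plus (minus x y) y.
  by rewrite /minus -plus_assoc plus_opp_l plus_zero_r.
by rewrite e plus_zero_l.
Qed.

Lemma Cmult_integral (a b : C) : Cmult a b = RtoC 0 -> a = RtoC 0 \/ b = RtoC 0.
Proof.
move=> h; case: (classic (a = RtoC 0)) => [|a0]; first by left.
by right; apply: NNPP => b0; case: (Cmult_neq_0 a b a0 b0).
Qed.

(* Linear identities between vectors are checked in C after pairing with an
   arbitrary vector. *)
Ltac inner_simpl := apply: inner_ext => ?;
  rewrite ?(inner_minus_l, inner_plus_l, inner_opp_l, inner_scal_l, inner_zero_l).

Lemma is_linear_inner (X : HilbertSpace) (e : X) :
  is_linear (U := real_NormedModule X) (V := C_over_R) (fun x => inner x e).
Proof.
split.
- by move=> x y; apply: inner_plus_l.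
- move=> k x; rewrite C_over_R_scal; exact: inner_scal_l.
- exists (norm e + 1); split; first by have := norm_ge_0 e; lra.
  move=> x; rewrite norm_C_over_R; apply: Rle_trans (Cauchy_Schwarz X x e) _.
  rewrite -/(@norm C_AbsRing X x) Rmult_comm; apply: Rmult_le_compat_r; last lra.
  exact: norm_ge_0.
Qed.

Lemma is_linear_scal_vector (X : HilbertSpace) (e : X) :
  is_linear (U := C_over_R) (V := real_NormedModule X)
    (fun c => scal (c : C_Ring) e).
Proof.
split.
- move=> x y; exact: (scal_distr_r (K := C_Ring) x y e).
- move=> k x; rewrite C_over_R_scal; symmetry.
  exact: (scal_assoc (K := C_Ring) (RtoC k) x e).
- exists (norm e + 1); split; first by have := norm_ge_0 e; lra.
  move=> x; rewrite norm_C_over_R.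
  apply: Rle_trans (norm_scal (x : C_AbsRing) e) _.
  rewrite Rmult_comm; apply: Rmult_le_compat_r; [exact: Cmod_ge_0 | lra].
Qed.

Lemma tends_to_norm (X : HilbertSpace) (u : nat -> X) (x : X) :
  tends_to u x <-> forall eps : posreal,
    exists N, forall k, (N <= k)%coq_nat -> norm (minus (u k) x) < eps.
Proof. exact: filterlim_locally_ball_norm. Qed.

Lemma tends_to_const (X : HilbertSpace) (x : X) : tends_to (fun _ => x) x.
Proof. exact: filterlim_const. Qed.

Lemma inner_tends_to (X : HilbertSpace) (u : nat -> X) (x e : X) :
  tends_to u x ->
  filterlim (fun k => inner (u k) e : C_over_R) eventually (locally (inner x e : C_over_R)).
Proof.
move=> H.
apply: (filterlim_comp _ _ _ u (fun x => inner x e : C_over_R) _ (locally x)) => //.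
exact: (linear_cont _ _ (is_linear_inner X e)).
Qed.

(** Carries an identity between pairings from the graph of an operator to its closure, as the
    definition of [fpow] requires. *)
Lemma inner_tends_to_eq (X : HilbertSpace) (u v : nat -> X) (x y e f : X) (c : C) :
  tends_to u x -> tends_to v y ->
  (forall k, inner (v k) f = Cmult c (inner (u k) e)) ->
  inner y f = Cmult c (inner x e).
Proof.
move=> hu hv h.
have hu' : tends_to (fun k => scal (c : C_Ring) (u k)) (scal (c : C_Ring) x).
  apply: (filterlim_comp _ _ _ u (fun x => scal (c : C_Ring) x) _ (locally x)) => //.
  exact: filterlim_scal_r.
have l1 := inner_tends_to X _ _ f hv; have l2 := inner_tends_to X _ _ e hu'.
rewrite -inner_scal_l.
apply: (filterlim_locally_unique (V := C_over_R) _ _ _ _ l2).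
apply: filterlim_ext l1 => k; by rewrite h inner_scal_l.
Qed.

Lemma inner_limit_eq0 (X : HilbertSpace) (u : nat -> X) (x e : X) :
  tends_to u x -> (forall k, inner (u k) e = RtoC 0) -> inner x e = RtoC 0.
Proof.
move=> hu h.
rewrite (inner_tends_to_eq X u u x x e e (RtoC 0) hu hu); first ring.
by move=> k; rewrite h; ring.
Qed.

(** The norm axiom [norm_scal] is an inequality; the inner product gives equality. *)
Lemma norm_scal_C (X : HilbertSpace) (c : C) (x : X) :
  norm (scal (c : C_Ring) x) = Cmod c * norm x.
Proof.
have h : norm (scal (c : C_Ring) x) ^ 2 = (Cmod c * norm x) ^ 2.
  have := inner_norm (scal (c : C_Ring) x).
  rewrite inner_scal_l inner_scal_r Cmult_assoc -Cmod2_conj inner_norm.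
  by rewrite -RtoC_mult => /(f_equal Re) /= <-; ring.
have n1 := norm_ge_0 (scal (c : C_Ring) x).
have n2 := Rmult_le_pos _ _ (Cmod_ge_0 c) (norm_ge_0 x).
apply: Rle_antisym; apply: Rsqr_incr_0_var => //; rewrite !Rsqr_pow2 h; lra.
Qed.

Lemma norm_triangle_minus (X : HilbertSpace) (x y : X) :
  norm (minus x y) <= norm x + norm y.
Proof. by rewrite -(norm_opp y); apply: norm_triangle. Qed.

(** * A symmetric compact inverse has no nonzero vector orthogonal to all eigenvectors *)

Section CompactInverse.
Variables (X : HilbertSpace) (A : operator X) (K : X -> X) (B : R).
Hypothesis linA : linear_operator A.
Hypothesis saA : self_adjoint A.
Hypothesis AK : forall y, A (K y) y.
Hypothesis AKuniq : forall x y, A x y -> x = K y.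
Hypothesis KB : forall y, norm (K y) <= B * norm y.
Hypothesis Kcompact : forall u : nat -> X, (forall k, norm (u k) <= 1) ->
  exists (phi : nat -> nat) (l : X),
    (forall k, (phi k < phi k.+1)%N) /\ tends_to (fun k => K (u (phi k))) l.

Lemma K_minus x y : K (minus x y) = minus (K x) (K y).
Proof.
case: linA => _ _ aD aZ; symmetry; apply: AKuniq; apply: aD => //.
have -> : opp (K y) = scal (opp one : C_Ring) (K y) by rewrite scal_opp_one.
have -> : opp y = scal (opp one : C_Ring) y by rewrite scal_opp_one.
exact: aZ.
Qed.

Lemma K_scal (c : C) x : K (scal (c : C_Ring) x) = scal (c : C_Ring) (K x).
Proof. by case: linA => _ _ _ aZ; symmetry; apply: AKuniq; apply: aZ. Qed.

Lemma K_inj0 x : K x = zero -> x = zero.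
Proof. by case: linA => fA A0 _ _ e; apply: (fA zero) => //; rewrite -e. Qed.

Lemma K_symm x y : inner (K x) y = inner x (K y).
Proof.
have := proj2 (saA _ _) (AK y); rewrite /adjoint => h.
by rewrite (h _ _ (AK x)).
Qed.

Definition orth_eigen (y : X) := forall (e : X) (c : C), A e (scal (c : C_Ring) e) ->
  inner y e = RtoC 0.

Lemma orth_eigen_minus x y : orth_eigen x -> orth_eigen y -> orth_eigen (minus x y).
Proof. by move=> hx hy e c h; rewrite inner_minus_l (hx e c h) (hy e c h); ring. Qed.

Lemma orth_eigen_scal (c : C) x : orth_eigen x -> orth_eigen (scal (c : C_Ring) x).
Proof. by move=> hx e d h; rewrite inner_scal_l (hx e d h); ring. Qed.

(** By symmetry [<K x, e> = <x, K e>], and [K e] is a multiple of [e] when the eigenvalue is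
    nonzero; eigenvalue 0 forces [e = 0] because [A] is injective. *)
Lemma orth_eigen_K x : orth_eigen x -> orth_eigen (K x).
Proof.
move=> hx e c h; have [c0|c0] := excluded_middle_informative (c = RtoC 0).
  have -> : e = zero.
    rewrite (AKuniq _ _ h) c0; have -> : scal (RtoC 0 : C_Ring) e = zero.
      exact: (scal_zero_l (K := C_Ring)).
    case: linA => _ A0 _ _; symmetry; exact: AKuniq.
  by rewrite inner_conj inner_zero_l /Cconj /RtoC /= Ropp_0.
rewrite K_symm.
have h' : e = scal (c : C_Ring) (K e) by rewrite -K_scal; apply: AKuniq.
have := hx e c h; rewrite {1}h' inner_scal_r => /Cmult_integral [] // cc.
by case: c0; rewrite -(Cconj_conj c) cc /Cconj /RtoC /= Ropp_0.
Qed.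

(** Such an [x] satisfies [A x = c^(-1) x], so it is orthogonal to itself. *)
Lemma orth_eigen_eigenvector0 (c : C) x :
  orth_eigen x -> c <> RtoC 0 -> K x = scal (c : C_Ring) x -> x = zero.
Proof.
move=> hx c0 h; apply: inner_self_eq0; apply: (hx x (Cinv c)).
case: linA => _ _ _ aZ.
have e : x = scal (Cinv c : C_Ring) (K x) by rewrite h; inner_simpl; field.
by rewrite {1}e; apply: aZ.
Qed.

Lemma orth_eigen_lim (u : nat -> X) x :
  tends_to u x -> (forall k, orth_eigen (u k)) -> orth_eigen x.
Proof.
move=> hu h e c he; apply: inner_limit_eq0 hu _ => k; exact: (h k e c).
Qed.

(* Along a maximizing sequence [x_k] of unit vectors, [K (K x_k) - m^2 x_k]
   tends to [0]; [y] is the limit of a subsequence of [K x_k]. *)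
Lemma orth_eigen_approx (m : R) :
  (forall y, orth_eigen y -> norm (K y) <= m * norm y) ->
  (forall eps : posreal, exists x, [/\ orth_eigen x, norm x = 1 & m - eps < norm (K x)]) ->
  0 < m ->
  exists2 y, orth_eigen y /\ y <> zero & K (K y) = scal (RtoC (m ^ 2) : C_Ring) y.
Proof.
move=> Km appr m0.
have B0 : 0 <= B.
  have [x [_ x1 _]] := appr (mkposreal 1 Rlt_0_1).
  by have := KB x; have := norm_ge_0 (K x); rewrite x1; lra.
have ip k : 0 < / (INR k + 1) by apply: Rinv_0_lt_compat; have := pos_INR k; lra.
have [x hx] : exists x : nat -> X, forall k,
    [/\ orth_eigen (x k), norm (x k) = 1 & m - / (INR k + 1) < norm (K (x k))].
  exists (fun k => proj1_sig (constructive_indefinite_description _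
    (appr (mkposreal _ (ip k))))) => k.
  exact: (proj2_sig (constructive_indefinite_description _
    (appr (mkposreal _ (ip k))))).
pose z k := minus (K (K (x k))) (scal (RtoC (m ^ 2) : C_Ring) (x k)).
(* With [a = |K x_k|], expanding the square gives at most [m^2 a^2 - 2 m^2 a^2 + m^4 = m^2 (m + a)
   (m - a)], where [a <= m] and [m - a < 1 / (k + 1)]. *)
have zb k : norm (z k) ^ 2 <= 2 * m ^ 3 * / (INR k + 1).
  have [o n1 lt] := hx k.
  have e : RtoC (norm (z k) ^ 2) = RtoC (norm (K (K (x k))) ^ 2
      - 2 * m ^ 2 * norm (K (x k)) ^ 2 + m ^ 4 * norm (x k) ^ 2).
    rewrite -inner_norm /z !inner_minus_l !inner_minus_r !inner_scal_l !inner_scal_r.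
    rewrite (K_symm (K (x k)) (x k)).
    have -> : inner (x k) (K (K (x k))) = inner (K (x k)) (K (x k)) by rewrite K_symm.
    rewrite !inner_norm.
    have -> : Cconj (RtoC (m ^ 2)) = RtoC (m ^ 2) by rewrite /Cconj /RtoC /= Ropp_0.
    have -> : m ^ 4 = m ^ 2 * m ^ 2 by ring.
    move: (norm _ ^ 2) (norm _ ^ 2) (norm _ ^ 2) (m ^ 2) => p q r s.
    by rewrite RtoC_plus RtoC_minus !RtoC_mult; ring.
  have {}e := RtoC_inj _ _ e.
  have h1 := Km (K (x k)) (orth_eigen_K _ o).
  have h2 := Km (x k) o.
  rewrite n1 in e h2.
  have p1 := norm_ge_0 (K (x k)); have p2 := norm_ge_0 (K (K (x k))).
  set a := norm (K (x k)) in e h1 h2 p1 lt.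
  set b := norm (K (K (x k))) in e h1 p2.
  have q1 : b ^ 2 <= m ^ 2 * a ^ 2 by rewrite -Rpow_mult_distr; apply: pow_incr.
  have q2 : m ^ 2 - a ^ 2 <= 2 * m * / (INR k + 1).
    have -> : m ^ 2 - a ^ 2 = (m + a) * (m - a) by ring.
    have i0 := ip k; apply: Rmult_le_compat; lra.
  have := Rmult_le_compat_l (m ^ 2) _ _ (pow2_ge_0 m) q2; rewrite e.
  nra.
have [|phi [y [hphi hy]]] := Kcompact x; first by move=> k; have [_ -> _] := hx k; lra.
have phige k : (k <= phi k)%N.
  elim: k => // k IH; exact: leq_ltn_trans IH (hphi k).
have oy : orth_eigen y.
  apply: orth_eigen_lim hy _ => k; apply: orth_eigen_K; by have [] := hx (phi k).
have near (eps : posreal) : exists k, [/\ norm (minus (K (x (phi k))) y) < eps,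
    norm (z (phi k)) < eps & m - eps < norm (K (x (phi k)))].
  have [N1 h1] := proj1 (tends_to_norm _ _ _) hy eps.
  (* The first entry serves [m - eps < |K x_k|], the second turns the bound [zb] into
     [|z_k|^2 < eps^2]. *)
  have e2 : 0 < Rmin eps (eps ^ 2 / (2 * m ^ 3)).
    apply: Rmin_glb_lt; first exact: cond_pos.
    by apply: Rdiv_lt_0_compat; [apply: pow_lt; apply: cond_pos | have := pow_lt m 3 m0; lra].
  have [N2 [h2 N2p]] := archimed_cor1 _ e2.
  pose k := maxn N1 N2; exists k.
  have kN1 : (N1 <= k)%coq_nat by apply/leP; exact: leq_maxl.
  have kN2 : INR N2 <= INR (phi k).
    by apply: le_INR; apply/leP; apply: leq_trans (phige k); exact: leq_maxr.
  have i2 : / (INR (phi k) + 1) < Rmin eps (eps ^ 2 / (2 * m ^ 3)).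
    apply: Rle_lt_trans h2; apply: Rinv_le_contravar; last lra.
    exact: lt_0_INR.
  have i3 := Rlt_le_trans _ _ _ i2 (Rmin_l _ _).
  have i4 := Rlt_le_trans _ _ _ i2 (Rmin_r _ _).
  split; first exact: h1.
    apply: Rsqr_incrst_0; [|exact: norm_ge_0 | exact/Rlt_le/cond_pos].
    rewrite !Rsqr_pow2; apply: Rle_lt_trans (zb _) _.
    have m3 : 0 < 2 * m ^ 3 by have := pow_lt m 3 m0; lra.
    have -> : eps ^ 2 = 2 * m ^ 3 * (eps ^ 2 / (2 * m ^ 3)) by field; lra.
    exact: Rmult_lt_compat_l.
  have [_ _] := hx (phi k); lra.
exists y; first split => // y0.
  have e0 : 0 < m / 3 by lra.
  have [k [h1 _ h2]] := near (mkposreal _ e0).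
  rewrite y0 /minus opp_zero plus_zero_r /= in h1 h2; lra.
have -> : K (K y) = plus (minus (K (K y)) (scal (RtoC (m ^ 2) : C_Ring) y))
    (scal (RtoC (m ^ 2) : C_Ring) y) by inner_simpl; ring.
set N := minus _ _; suff -> : N = zero by rewrite plus_zero_l.
apply: norm_eq_zero; apply: Rle_antisym; last exact: norm_ge_0.
apply: Rnot_lt_le => lt.
(* With [w = K x_k - y], the defect is [N = K z_k - K (K w) + m^2 w], of norm at most
   [(B + B^2 + m^2) eps]; the extra 1 makes the contradiction strict. *)
have C0 : 0 < B * B + m ^ 2 + B + 1 by nra.
have e0 : 0 < norm N / (B * B + m ^ 2 + B + 1) by apply: Rdiv_lt_0_compat.
have [k [h1 h2 _]] := near (mkposreal _ e0); rewrite /= in h1 h2.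
set w := minus (K (x (phi k))) y in h1.
have eN : N = plus (minus (K (z (phi k))) (K (K w))) (scal (RtoC (m ^ 2) : C_Ring) w).
  by rewrite /N /w /z !K_minus K_scal; inner_simpl; ring.
have b1 : norm N <= (B * norm (z (phi k)) + B * (B * norm w)) + m ^ 2 * norm w.
  rewrite eN; apply: Rle_trans (norm_triangle _ _) _.
  apply: Rplus_le_compat.
    apply: Rle_trans (norm_triangle_minus _ _ _) _.
    apply: Rplus_le_compat; first exact: KB.
    apply: Rle_trans (KB _) _; apply: Rmult_le_compat_l => //; exact: KB.
  rewrite norm_scal_C Cmod_R Rabs_pos_eq; [lra | exact: pow2_ge_0].
set eps := norm N / _ in h1 h2.
have eN' : norm N = (B * B + m ^ 2 + B + 1) * eps by rewrite /eps; field; lra.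
have := norm_ge_0 w; have := norm_ge_0 (z (phi k)).
have : B * norm (z (phi k)) <= B * eps by apply: Rmult_le_compat_l; lra.
have : (B * B + m ^ 2) * norm w <= (B * B + m ^ 2) * eps.
  by apply: Rmult_le_compat_l; nra.
have : 0 < eps by [].
lra.
Qed.

(** Otherwise [K], being injective, has a positive norm [m] on the space of these vectors, and some
    [y <> 0] there satisfies [(K + m) (K - m) y = 0]. Either [(K - m) y] or [y] itself is then a
    nonzero eigenvector of [K] in that space. *)
Lemma orth_eigen_eq0 x : orth_eigen x -> x = zero.
Proof.
move=> ox; apply: NNPP => x0.
have nx : 0 < norm x.
  have [|e] := Rle_lt_or_eq_dec _ _ (norm_ge_0 x) => //.
  by case: x0; apply: norm_eq_zero.
have unit y : orth_eigen y -> 0 < norm y ->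
    orth_eigen (scal (RtoC (/ norm y) : C_Ring) y) /\
    norm (scal (RtoC (/ norm y) : C_Ring) y) = 1 /\
    norm (K (scal (RtoC (/ norm y) : C_Ring) y)) = norm (K y) / norm y.
  move=> oy ny; split; first exact: orth_eigen_scal.
  have ip : 0 < / norm y by apply: Rinv_0_lt_compat.
  rewrite K_scal !norm_scal_C Cmod_R Rabs_pos_eq; last lra.
  by split; field; lra.
pose E v := exists y, [/\ orth_eigen y, norm y = 1 & v = norm (K y)].
have [ox' [nx' nKx]] := unit x ox nx.
have [m [ub lub]] : {m | is_lub E m}.
  apply: completeness.
    by exists B => v [y [_ n1 ->]]; have := KB y; rewrite n1 Rmult_1_r.
  by exists (norm (K (scal (RtoC (/ norm x) : C_Ring) x))), (scal (RtoC (/ norm x) : C_Ring) x).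
have Km y : orth_eigen y -> norm (K y) <= m * norm y.
  move=> oy; have [ny|ny] := Rle_lt_or_eq_dec _ _ (norm_ge_0 y).
    have [o1 [n1 n2]] := unit y oy ny.
    have : norm (K y) / norm y <= m.
      by rewrite -n2; apply: ub; exists (scal (RtoC (/ norm y) : C_Ring) y).
    move=> h; have -> : norm (K y) = norm (K y) / norm y * norm y by field; lra.
    by apply: Rmult_le_compat_r => //; lra.
  by have := KB y; rewrite -ny !Rmult_0_r.
have m0 : 0 < m.
  apply: Rlt_le_trans (_ : norm (K (scal (RtoC (/ norm x) : C_Ring) x)) <= m).
    rewrite nKx; apply: Rdiv_lt_0_compat => //.
    have [|e] := Rle_lt_or_eq_dec _ _ (norm_ge_0 (K x)) => //.
    by case: x0; apply: K_inj0; apply: norm_eq_zero.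
  by apply: ub; exists (scal (RtoC (/ norm x) : C_Ring) x).
have [eps|y [oy y0] hy] := orth_eigen_approx m Km _ m0.
  apply: NNPP => H; have : m <= m - eps.
    apply: lub => v [y [h1 h2 ->]]; apply: Rnot_lt_le => h3.
    by apply: H; exists y.
  have := cond_pos eps; lra.
pose v := minus (K y) (scal (RtoC m : C_Ring) y).
have mC : RtoC m <> RtoC 0 by move=> /RtoC_inj; lra.
have v0 : v = zero.
  apply: (orth_eigen_eigenvector0 (Copp (RtoC m))).
  - by apply: orth_eigen_minus; [apply: orth_eigen_K | apply: orth_eigen_scal].
  - by move=> h; move: h => /(f_equal Re) /=; lra.
  - by rewrite /v K_minus K_scal hy; inner_simpl; rewrite RtoC_pow; ring.
apply: y0; apply: (orth_eigen_eigenvector0 (RtoC m)) => //.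
have -> : K y = plus v (scal (RtoC m : C_Ring) y) by rewrite /v; inner_simpl; ring.
by rewrite v0 plus_zero_l.
Qed.

End CompactInverse.

Lemma norm_scal_minus_le (X : HilbertSpace) (c : C) (M : R) (x y : X) :
  norm x <= M -> norm (minus (scal (c : C_Ring) x) y) <= Cmod c * M + norm y.
Proof.
move=> h; apply: Rle_trans (norm_triangle_minus _ _ _) _.
rewrite norm_scal_C; apply: Rplus_le_compat_r.
by apply: Rmult_le_compat_l => //; apply: Cmod_ge_0.
Qed.

Lemma eigenvectors_complete (X : HilbertSpace) (A : operator X) (lambda0 : R) (x : X) :
  linear_operator A -> self_adjoint A -> 0 < lambda0 ->
  (forall z : C, spectrum A z -> lambda0 < Re z) -> compact_resolvent A ->
  (forall (e : X) (c : C), A e (scal (c : C_Ring) e) -> inner x e = RtoC 0) ->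
  x = zero.
Proof.
move=> linA saA l0 spec [z0 _ [_ comp]] ox.
have [ex [B bd]] : resolvent_set A (RtoC 0).
  by apply: NNPP => H; have := spec (RtoC 0) H; rewrite /=; lra.
case: (linA) => fA A0 aD aZ.
(* At 0 the resolvent is [- A^(-1)], hence the sign. *)
have res0 y u : resolvent (RtoC 0) A y u <-> A u (opp y).
  rewrite /resolvent /inv_op /shift_op /opp_op.
  have -> : opp (minus y (scal (RtoC 0 : C_Ring) u)) = opp y; last by [].
  by inner_simpl; ring.
have exK y : exists u, A u y.
  have [u [hu _]] := ex (opp y); exists u.
  by have := proj1 (res0 _ _) hu; rewrite opp_opp.
pose K y := proj1_sig (constructive_indefinite_description _ (exK y)).
have AK y : A (K y) y by rewrite /K; case: constructive_indefinite_description.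
have AKuniq u y : A u y -> u = K y.
  move=> h; have [v [_ uniq]] := ex (opp y).
  have r w : A w y -> v = w.
    by move=> hw; apply: uniq; apply/res0; rewrite opp_opp.
  by rewrite -(r _ h) -(r _ (AK y)).
have KB y : norm (K y) <= B * norm y.
  have := bd (opp y) (K y); rewrite norm_opp; apply.
  by apply/res0; rewrite opp_opp.
have B0 : forall y : X, norm y <= 1 -> norm (K y) <= Rabs B.
  move=> y y1; apply: Rle_trans (KB y) _.
  apply: Rle_trans (Rmult_le_compat_r _ _ _ (norm_ge_0 y) (Rle_abs B)) _.
  by rewrite -[X in _ <= X]Rmult_1_r; apply: Rmult_le_compat_l => //; apply: Rabs_pos.
apply: (orth_eigen_eq0 X A K B) => // u hu.
(* Compactness moves from [z0] to 0 by [A^(-1) u = (z0 - A)^(-1) (z0 A^(-1) u - u)], whose argument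
   remains bounded along the sequence. *)
apply: (comp (fun k => minus (scal (z0 : C_Ring) (K (u k))) (u k)) (fun k => K (u k))).
  exists (Cmod z0 * Rabs B + 1) => k.
  apply: Rle_trans (norm_scal_minus_le _ _ _ _ _ (B0 _ (hu k))) _.
  by apply: Rplus_le_compat_l.
move=> k; rewrite /resolvent /inv_op /shift_op /opp_op.
have -> : opp (minus (minus (scal (z0 : C_Ring) (K (u k))) (u k))
   (scal (z0 : C_Ring) (K (u k)))) = u k by inner_simpl; ring.
exact: AK.
Qed.

Lemma has_dim_0 (X : HilbertSpace) (P : X -> Prop) (d : nat) (x : X) :
  has_dim P d -> P x -> x <> zero -> (0 < d)%N.
Proof.
case: d => // -[b [_ h]] Px x0; case: x0.
by have [c [-> _]] := h x Px; rewrite /lin_comb big_ord0.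
Qed.

Lemma has_dim_S (X : HilbertSpace) (P : X -> Prop) (d : nat) :
  has_dim P d.+1 -> exists2 x, P x & x <> zero.
Proof.
move=> [b [h1 h2]]; apply: NNPP => H.
have all0 x : P x -> x = zero by move=> Px; apply: NNPP => x0; apply: H; exists x.
have P0 := h1 (fun _ => RtoC 0).
have [c [_ uniq]] := h2 _ P0.
(* If zero were the only vector of [P], the constant coefficients 0 and 1 would both represent it,
   against uniqueness; this uses that there is at least one coefficient. *)
have e1 := uniq (fun _ => RtoC 0) erefl.
have e2 : c = fun _ => RtoC 1.
  by apply: uniq; rewrite (all0 _ P0) (all0 _ (h1 _)).
have := f_equal (fun f => f ord0) (etrans (esym e1) e2).
by move=> /RtoC_inj; lra.
Qed.

Lemma ordered_eigenvalues_ex (X : HilbertSpace) (A : operator X) (mu : nat -> R) (j : nat) :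
  ordered_eigenvalues A mu ->
  exists2 e : X, A e (scal (RtoC (mu j) : C_Ring) e) & e <> zero.
Proof.
move=> [_ h]; have [s [_ hs hd]] := h (RtoC (mu j)).
case: s hs hd => [hs _|a s _]; last exact: has_dim_S.
by have := proj2 (hs j) erefl.
Qed.

Lemma ordered_eigenvalues_all (X : HilbertSpace) (A : operator X) (mu : nat -> R)
    (c : C) (e : X) :
  ordered_eigenvalues A mu -> A e (scal (c : C_Ring) e) -> e <> zero ->
  exists j, c = RtoC (mu j).
Proof.
move=> [_ h] he e0; have [s [_ hs hd]] := h c.
have := has_dim_0 _ _ _ e hd he e0.
case: s hs hd => // j s hs _ _; exists j.
by symmetry; apply/hs; rewrite inE eqxx.
Qed.

Lemma eigenvalue_gt0 (X : HilbertSpace) (A : operator X) (m : R) (e : X) :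
  positive_definite A -> A e (scal (RtoC m : C_Ring) e) -> e <> zero -> 0 < m.
Proof.
move=> pd he e0; have [+ _] := pd _ _ he e0.
rewrite inner_scal_l inner_norm /= => h.
have := norm_ge_0 e; nra.
Qed.

(** * Fractional powers of [A] tested on eigenvectors *)

Lemma is_linear_Cmult_r (k : C) :
  is_linear (U := C_over_R) (V := C_over_R) (fun c => Cmult c k).
Proof.
split.
- by move=> x y; apply: Cmult_plus_distr_r.
- by move=> l x; rewrite !C_over_R_scal Cmult_assoc.
- exists (Cmod k + 1); split; first by have := Cmod_ge_0 k; lra.
  move=> x; rewrite !norm_C_over_R Cmod_mult Rmult_comm.
  by apply: Rmult_le_compat_r; [exact: Cmod_ge_0 | lra].
Qed.

Lemma is_RInt_gen_C_unique (f : R -> C) (l l' : C) :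
  is_RInt_gen (V := C_over_R) f (at_right 0) (Rbar_locally p_infty) l ->
  is_RInt_gen (V := C_over_R) f (at_right 0) (Rbar_locally p_infty) l' -> l = l'.
Proof.
move=> H H'; apply: injective_projections.
- apply: is_RInt_gen_R_unique
    (is_RInt_gen_linear _ _ _ (is_linear_fst (U := R_NormedModule) (V := R_NormedModule)) _ _ H)
    (is_RInt_gen_linear _ _ _ (is_linear_fst (U := R_NormedModule) (V := R_NormedModule)) _ _ H').
- apply: is_RInt_gen_R_unique
    (is_RInt_gen_linear _ _ _ (is_linear_snd (U := R_NormedModule) (V := R_NormedModule)) _ _ H)
    (is_RInt_gen_linear _ _ _ (is_linear_snd (U := R_NormedModule) (V := R_NormedModule)) _ _ H').
Qed.

(** The case [phi = 0] and exponent [1 - b] of [stieltjes_integral], multiplied by [m]. *)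
Lemma balakrishnan_scalar (b m : R) : 0 < b < 1 -> 0 < m ->
  is_RInt_gen (V := C_over_R)
    (fun l => Cmult (RtoC (Rpower l (b - 1))) (RtoC (m / (l + m))))
    (at_right 0) (Rbar_locally p_infty)
    (RtoC (PI / sin (b * PI) * Rpower m b)).
Proof.
move=> hb m0; have pi0 := PI_RGT_0.
have h : is_RInt_gen (V := C_over_R) _ _ _ _ :=
  stieltjes_integral (1 - b) m 0 (ltac:(lra)) m0 (ltac:(lra)).
have := is_RInt_gen_linear _ _ _ (is_linear_Cmult_r (RtoC m)) _ _ h.
have -> : Cmult (Cmult (RtoC (PI / sin ((1 - b) * PI)))
    (polar (Rpower m (- (1 - b))) (- ((1 - b) * 0)))) (RtoC m) =
    RtoC (PI / sin (b * PI) * Rpower m b).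
  have -> : (1 - b) * PI = PI - b * PI by ring.
  rewrite sin_PI_x /polar Rmult_0_r Ropp_0 cos_0 sin_0.
  have -> : Rpower m b = Rpower m (- (1 - b)) * m.
    by rewrite -{3}(Rpower_1 m m0) -Rpower_plus; congr Rpower; ring.
  by rewrite /Cmult /RtoC /=; congr pair; ring.
apply: is_RInt_gen_ext_pos => l l0.
have -> : b - 1 = - (1 - b) by ring.
rewrite /polar cos_0 sin_0 /Cmult /Cinv /Cplus /RtoC /=.
by congr pair; field; nra.
Qed.

Section FractionalPower.
Variables (X : HilbertSpace) (A : operator X) (e : X) (m : R).
Hypothesis linA : linear_operator A.
Hypothesis m0 : 0 < m.
Hypothesis Ae : A e (scal (RtoC m : C_Ring) e).

(** On [e] the operator [A (l + A)^(-1)] is multiplication by [m / (l + m)], so the integral is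
    scalar. Constant sequences place the pair in the closure. *)
Lemma fpow_eigenvector (b : R) : 0 <= b <= 1 ->
  fpow A b e (scal (RtoC (Rpower m b) : C_Ring) e).
Proof.
move=> hb; rewrite /fpow; case: Req_EM_T => /= [-> | b0].
  by rewrite Rpower_O // /id_op; inner_simpl; ring.
case: Req_EM_T => /= [-> | b1]; first by rewrite Rpower_1.
have hb' : 0 < b < 1 by lra.
have s0 : 0 < sin (b * PI) by have := PI_RGT_0 => ?; apply: sin_gt_0; nra.
exists (fun _ => e), (fun _ => scal (RtoC (Rpower m b) : C_Ring) e).
split; [|exact: tends_to_const|exact: tends_to_const] => _.
split; first by exists (scal (RtoC m : C_Ring) e).
exists (fun l => scal (RtoC (m / (l + m)) : C_Ring) e),
  (scal (RtoC (PI / sin (b * PI) * Rpower m b) : C_Ring) e).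
case: linA => _ _ _ aZ.
split.
- move=> l l0; exists (scal (RtoC (/ (l + m)) : C_Ring) e).
    rewrite /inv_op /shift_op.
    have -> : minus e (scal (RtoC l : C_Ring) (scal (RtoC (/ (l + m)) : C_Ring) e)) =
      scal (RtoC (/ (l + m)) : C_Ring) (scal (RtoC m : C_Ring) e); last exact: aZ.
    inner_simpl; rewrite RtoC_inv ?RtoC_plus; last lra.
    field => h; have := RtoC_inj (l + m) 0; rewrite RtoC_plus => /(_ h); lra.
  have -> : scal (RtoC (m / (l + m)) : C_Ring) e =
    scal (RtoC (/ (l + m)) : C_Ring) (scal (RtoC m : C_Ring) e); last exact: aZ.
  by inner_simpl; rewrite /Rdiv RtoC_mult; ring.
- have := is_RInt_gen_linear _ _ _ (is_linear_scal_vector X e) _ _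
    (balakrishnan_scalar b m hb' m0).
  rewrite /is_int; apply: is_RInt_gen_ext_pos => l l0.
  by inner_simpl; ring.
- inner_simpl; rewrite Cmult_assoc -RtoC_mult; congr (Cmult (RtoC _) _).
  by have pi0 := PI_RGT_0; field; lra.
Qed.

Hypothesis saA : self_adjoint A.

Lemma inner_eigen (t u : X) : A t u -> inner u e = Cmult (RtoC m) (inner t e).
Proof.
move=> h; rewrite (proj2 (saA _ _) Ae _ _ h) inner_scal_r; congr Cmult.
by rewrite /Cconj /RtoC /= Ropp_0.
Qed.

(** If [(l + A) t = v], self-adjointness gives [<v, e> = (l + m) <t, e>] and [<A t, e> = m <t, e>],
    so pairing with [e] reduces the formula to its scalar case. *)
Lemma inner_balakrishnan (b : R) (v w : X) : 0 < b < 1 ->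
  balakrishnan A b v w -> inner w e = Cmult (RtoC (Rpower m b)) (inner v e).
Proof.
move=> hb [_ [h [J [hh hJ ->]]]].
have s0 : 0 < sin (b * PI) by have := PI_RGT_0 => ?; apply: sin_gt_0; nra.
have H1 := is_RInt_gen_linear _ _ _ (is_linear_inner X e) _ _ hJ.
have H2 := is_RInt_gen_linear _ _ _ (is_linear_Cmult_r (inner v e)) _ _
    (balakrishnan_scalar b m hb m0).
have E : inner J e = Cmult (RtoC (PI / sin (b * PI) * Rpower m b)) (inner v e).
  apply: is_RInt_gen_C_unique H1 _; apply: is_RInt_gen_ext_pos H2 => l l0.
  have [t ht1 ht2] := hh l l0.
  rewrite inner_scal_l (inner_eigen _ _ ht2).
  have := inner_eigen _ _ ht1; rewrite inner_minus_l inner_scal_l => ev.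
  have -> : inner v e = Cmult (RtoC (l + m)) (inner t e).
    by rewrite RtoC_plus Cmult_plus_distr_r -ev; ring.
  rewrite -Cmult_assoc (Cmult_assoc (RtoC (m / (l + m)))) -RtoC_mult.
  by congr (Cmult _ (Cmult (RtoC _) _)); field; lra.
rewrite inner_scal_l E Cmult_assoc -RtoC_mult; congr (Cmult (RtoC _) _).
by have pi0 := PI_RGT_0; field; lra.
Qed.

Lemma inner_fpow (b : R) (v w : X) : 0 <= b <= 1 ->
  fpow A b v w -> inner w e = Cmult (RtoC (Rpower m b)) (inner v e).
Proof.
move=> hb; rewrite /fpow; case: Req_EM_T => /= [-> | b0].
  by rewrite Rpower_O // /id_op => ->; ring.
case: Req_EM_T => /= [-> | b1]; first by rewrite Rpower_1 //; apply: inner_eigen.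
move=> [u [u' [h1 h2 h3]]]; apply: inner_tends_to_eq h2 h3 _ => k.
by apply: inner_balakrishnan (h1 k); lra.
Qed.

End FractionalPower.

(** * Left eigenforms and eigenvectors of Lambda *)

HB.instance Definition _ :=
  Monoid.isComLaw.Build C (RtoC 0) Cplus Cplus_assoc Cplus_comm Cplus_0_l.

Lemma Cmult_sum (I : Type) (r : seq I) (c : C) (F : I -> C) :
  Cmult c (\big[Cplus/RtoC 0]_(i <- r) F i) =
  \big[Cplus/RtoC 0]_(i <- r) Cmult c (F i).
Proof. exact: (big_morph _ (Cmult_plus_distr_l c) (Cmult_0_r c)). Qed.

Lemma Rsum_ge_term (n : nat) (F : 'I_n -> R) (j : 'I_n) :
  (forall i, 0 <= F i) -> F j <= \big[Rplus/0]_(i < n) F i.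
Proof.
elim: n F j => [|n IH] F j F0; first by case: j.
have S0 : 0 <= \big[Rplus/0]_(i < n) F (lift ord0 i).
  by elim/big_ind: _ => //; [lra | move=> x y; lra].
rewrite big_ord_recl; case: (unliftP ord0 j) => [k|] -> ; last lra.
have := IH (fun i => F (lift ord0 i)) k (fun i => F0 _); have := F0 ord0; lra.
Qed.

Lemma Rsum_scal (n : nat) (c : R) (F : 'I_n -> R) :
  c * \big[Rplus/0]_(i < n) F i = \big[Rplus/0]_(i < n) (c * F i).
Proof. exact: (big_morph _ (Rmult_plus_distr_l c) (Rmult_0_r c)). Qed.

Lemma Yexp_itv (n : nat) (i : 'I_n) : 0 <= Yexp i <= 1.
Proof.
have n0 : 0 < INR n by apply: lt_0_INR; apply/ltP; apply: leq_ltn_trans (ltn_ord i).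
rewrite /Yexp; split; first by apply: Rdiv_le_0_compat => //; apply: pos_INR.
apply: (Rmult_le_reg_r (INR n)) => //.
rewrite /Rdiv Rmult_assoc Rinv_l ?Rmult_1_r ?Rmult_1_l; last lra.
by apply: le_INR; apply/leP; rewrite -subnDA leq_subr.
Qed.

Section Functional.
Variables (X : HilbertSpace) (A : operator X) (n : nat) (e : X) (m : R) (zeta : C).
Hypothesis linA : linear_operator A.
Hypothesis saA : self_adjoint A.
Hypothesis m0 : 0 < m.
Hypothesis Ae : A e (scal (RtoC m : C_Ring) e).

(* For [zeta ^ n = - m] this is a left eigenvector of [Lambda], with
   eigenvalue [- zeta]. *)
Definition left_eigenform (v : 'I_n -> X) : C :=
  \big[Cplus/RtoC 0]_(i < n) Cmult (Cpow zeta (n - 1 - i)) (inner (v i) e).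

Lemma left_eigenform_plus (v w : 'I_n -> X) :
  left_eigenform (plus v w) = Cplus (left_eigenform v) (left_eigenform w).
Proof.
rewrite /left_eigenform -big_split; apply: eq_bigr => i _.
have -> : inner (plus v w i) e = Cplus (inner (v i) e) (inner (w i) e).
  exact: inner_plus_l.
exact: Cmult_plus_distr_l.
Qed.

Lemma left_eigenform_scal (c : C) (v : 'I_n -> X) :
  left_eigenform (scal (c : C_Ring) v) = Cmult c (left_eigenform v).
Proof.
rewrite /left_eigenform Cmult_sum; apply: eq_bigr => i _.
have -> : inner (scal (c : C_Ring) v i) e = Cmult c (inner (v i) e).
  exact: inner_scal_l.
ring.
Qed.

Lemma left_eigenform_minus (v w : 'I_n -> X) :
  left_eigenform (minus v w) = Cminus (left_eigenform v) (left_eigenform w).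
Proof.
rewrite /minus left_eigenform_plus.
have -> : opp w = scal (Copp (RtoC 1) : C_Ring) w.
  apply: functional_extensionality => i.
  exact: esym (scal_opp_one (K := C_Ring) (w i)).
by rewrite left_eigenform_scal; ring.
Qed.

(** The norm of Y controls [w_i = A^t v_i], and [<v_i, e> = m^(-t) <w_i, e>]; this explains the
    weight [norm e / m^t] in the constant. *)
Lemma left_eigenform_bound : exists M, 0 <= M /\
  forall v r, Ynorm A v r -> Cmod (left_eigenform v) <= M * r.
Proof.
pose F (i : 'I_n) := Cmod (Cpow zeta (n - 1 - i)) * (norm e / Rpower m (Yexp i)).
have F0 i : 0 <= F i.
  apply: Rmult_le_pos; first exact: Cmod_ge_0.
  by apply: Rdiv_le_0_compat; [exact: norm_ge_0 | exact: exp_pos].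
exists (\big[Rplus/0]_(i < n) F i); split.
  by elim/big_ind: _ => //; [lra | move=> x y; lra].
move=> v r [w [hw ->]]; set N := sqrt _.
apply: (big_ind2 (fun (x : C) (y : R) => Cmod x <= y * N)).
- by rewrite Cmod_0; lra.
- move=> x x' y y' hx hy; apply: Rle_trans (Cmod_triangle _ _) _; lra.
- move=> i _; rewrite Cmod_mult /F Rmult_assoc.
  apply: Rmult_le_compat_l; first exact: Cmod_ge_0.
  have p : 0 < Rpower m (Yexp i) by apply: exp_pos.
  apply: (Rmult_le_reg_l _ _ _ p).
  have -> : Rpower m (Yexp i) * (norm e / Rpower m (Yexp i) * N) = N * norm e.
    by field; lra.
  have -> : Rpower m (Yexp i) * Cmod (inner (v i) e) = Cmod (inner (w i) e).
    rewrite (inner_fpow X A e m m0 Ae saA _ _ _ (Yexp_itv n i) (hw i)).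
    by rewrite Cmod_mult Cmod_R Rabs_pos_eq; lra.
  apply: Rle_trans (Cauchy_Schwarz _ _ _) _.
  apply: Rmult_le_compat_r; first exact: norm_ge_0.
  rewrite -(sqrt_pow2 (norm (w i)) (norm_ge_0 _)).
  apply: sqrt_le_1_alt.
  exact: (Rsum_ge_term n (fun i => norm (w i) ^ 2) i (fun i => pow2_ge_0 _)).
Qed.

Lemma left_eigenform_near (J : 'I_n -> X) (P : C -> Prop) :
  locally (left_eigenform J : C_over_R) P ->
  locally_Y A J (fun v => P (left_eigenform v)).
Proof.
move=> [eps HP]; have [M [M0 HM]] := left_eigenform_bound.
have e0 : 0 < eps / (M + 1) by apply: Rdiv_lt_0_compat; [exact: cond_pos | lra].
exists (mkposreal _ e0) => v r hv /= hr; apply: HP.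
apply: C_NormedModule_mixin_compat1.
have -> : minus (left_eigenform v) (left_eigenform J) = left_eigenform (minus v J).
  by rewrite left_eigenform_minus.
have r0 : 0 <= r by case: hv => w [_ ->]; apply: sqrt_pos.
apply: Rle_lt_trans (HM _ _ hv) _.
have : (M + 1) * r < eps.
  have -> : (eps : R) = (M + 1) * (eps / (M + 1)) by field; lra.
  by apply: Rmult_lt_compat_l; lra.
lra.
Qed.

(** The form commutes with Riemann sums by linearity alone, and [left_eigenform_near] transports
    their convergence from Y to C. *)
Lemma left_eigenform_RInt (f : R -> 'I_n -> X) (a b : R) (J : 'I_n -> X) :
  is_RInt_Y A f a b J ->
  is_RInt (V := C_over_R) (fun l => left_eigenform (f l)) a b (left_eigenform J).
Proof.
move=> [_ H] P HP; have := H _ (left_eigenform_near _ _ HP).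
rewrite /filtermap; apply filter_imp => ptd.
rewrite left_eigenform_scal.
rewrite (Riemann_sum_morphism (real_ModuleSpace (fct_ModuleSpace 'I_n X)) C_over_R
   left_eigenform).
- by rewrite C_over_R_scal.
- exact: left_eigenform_plus.
- by move=> k x; rewrite C_over_R_scal; apply: left_eigenform_scal.
Qed.

Lemma left_eigenform_int (f : R -> 'I_n -> X) (J : 'I_n -> X) :
  is_int_Y A f J ->
  is_RInt_gen (V := C_over_R) (fun l => left_eigenform (f l))
    (at_right 0) (Rbar_locally p_infty) (left_eigenform J).
Proof.
move=> [_ H] P HP; have {}H := H _ (left_eigenform_near _ _ HP).
apply: zero_infty_imp H => ab [y [h1 h2]].
by exists (left_eigenform y); split => //; apply: left_eigenform_RInt.
Qed.

Hypothesis n0 : (0 < n)%N.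
Hypothesis zetan : Cpow zeta n = RtoC (- m).

(** For [i < n - 1] the term [- zeta^(n-1-i) <v_(i+1), e>] is [- zeta] times the term of [v_(i+1)].
    The last term [m <v_0, e>] closes the cycle because [m = - zeta^n]. *)
Lemma left_eigenform_Lambda (v w : 'I_n -> X) :
  Lambda A n v w -> left_eigenform w = Cmult (Copp zeta) (left_eigenform v).
Proof.
rewrite /left_eigenform; move: v w zetan n0.
case: (n) => // k v w zk _ [_ h].
(* The last term leaves the sum over [w] and the first one the sum over [v], so that the remaining
   terms match as [w_i] with [v_(i+1)]. *)
rewrite big_ord_recr big_ord_recl /=.
have hk : inner (w ord_max) e = Cmult (RtoC m) (inner (v ord0) e).
  have := h ord_max; rewrite /= ltnn => /(inner_eigen X A e m Ae saA) ->.
  by congr (Cmult _ (inner (v _) e)); apply: val_inj; rewrite /= modnn.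
rewrite hk Cmult_plus_distr_l Cmult_sum.
have -> : \big[Cplus/RtoC 0]_(i < k)
    Cmult (Cpow zeta (k.+1 - 1 - i)) (inner (w (widen_ord (leqnSn k) i)) e) =
  \big[Cplus/RtoC 0]_(i < k) Cmult (Copp zeta)
    (Cmult (Cpow zeta (k.+1 - 1 - bump 0 i)) (inner (v (lift ord0 i)) e)).
  apply: eq_bigr => i _.
  have := h (widen_ord (leqnSn k) i); rewrite /= ltnS ltn_ord => ->.
  have -> : ordS (widen_ord (leqnSn k) i) = lift ord0 i.
    by apply: val_inj; rewrite /= modn_small // ltnS ltn_ord.
  rewrite inner_opp_l /bump /= !subn1 /=.
  have -> : (k - i)%N = (k - (1 + i)).+1 by rewrite add1n subnSK.
  by rewrite Cpow_S; ring.
rewrite !subn1 /= subnn subn0 Cplus_comm; congr Cplus.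
have -> : Cmult (Copp zeta) (Cmult (Cpow zeta k) (inner (v ord0) e)) =
  Cmult (Copp (Cpow zeta k.+1)) (inner (v ord0) e) by rewrite Cpow_S; ring.
rewrite zk RtoC_opp /=; ring.
Qed.

End Functional.

(** * Polar form of complex numbers *)

Lemma polar_mult (r s x y : R) :
  Cmult (polar r x) (polar s y) = polar (r * s) (x + y).
Proof.
by rewrite /polar /Cmult cos_plus sin_plus /=; congr pair; ring.
Qed.

Lemma polar_pow (r x : R) (n : nat) :
  Cpow (polar r x) n = polar (r ^ n) (INR n * x).
Proof.
elim: n => [|n IH]; first by rewrite /polar /= Rmult_0_l cos_0 sin_0 /RtoC; congr pair; ring.
by rewrite Cpow_S IH polar_mult S_INR /=; congr (polar _); ring.
Qed.

Lemma polar_0 (r : R) : polar r 0 = RtoC r.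
Proof. by rewrite /polar cos_0 sin_0 /RtoC; congr pair; ring. Qed.

Lemma polar_opp (r x : R) : Copp (polar r x) = polar r (x + PI).
Proof. by rewrite /polar neg_cos neg_sin /Copp /=; congr pair; ring. Qed.

Lemma polar_2PI (r : R) (n : nat) : polar r (2 * PI * INR n) = RtoC r.
Proof.
rewrite -(polar_0 r) /polar.
have := cos_period 0 n; have := sin_period 0 n.
have -> : 0 + 2 * INR n * PI = 2 * PI * INR n by ring.
by move=> -> ->.
Qed.

Lemma RtoC_plus_polar_neq0 (l r phi : R) : 0 < l -> 0 < r -> - PI < phi < PI ->
  Cplus (RtoC l) (polar r phi) <> RtoC 0.
Proof.
move=> l0 r0 hp h; have := rot_den_gt0 r phi l r0 l0 hp; rewrite /rot_den.
have := f_equal fst h; have := f_equal snd h; rewrite /polar /Cplus /RtoC /= => h1 h2.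
rewrite Rplus_0_l in h1; rewrite h2 h1; lra.
Qed.

Section Eigenvectors.
Variables (X : HilbertSpace) (A : operator X) (n : nat) (e : X) (m : R) (zeta : C).
Variables (r phi : R).
Hypothesis linA : linear_operator A.
Hypothesis saA : self_adjoint A.
Hypothesis m0 : 0 < m.
Hypothesis Ae : A e (scal (RtoC m : C_Ring) e).
Hypothesis n0 : (0 < n)%N.
Hypothesis zetan : Cpow zeta n = RtoC (- m).
Hypothesis r0 : 0 < r.
Hypothesis hphi : - PI < phi < PI.
Hypothesis zeta_polar : Copp zeta = polar r phi.

Local Notation form := (left_eigenform X n e zeta).

(** With [c = - zeta], the form sends every admissible [g l] to [form w / (l + c)], so the form of
    the integral is a Stieltjes integral. *)
Lemma left_eigenform_fpow_neg (a : R) (v w : 'I_n -> X) : 0 < a < 1 ->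
  fpow_neg_Y A (Lambda A n) a w v ->
  form v = Cmult (polar (Rpower r (- a)) (- (a * phi))) (form w).
Proof.
move=> ha [_ [g [J [hg hJ ->]]]]; have pi0 := PI_RGT_0.
have s0 : 0 < sin (a * PI) by apply: sin_gt_0; nra.
have H1 := left_eigenform_int X A n e m zeta saA m0 Ae _ _ hJ.
have H2 := is_RInt_gen_linear _ _ _ (is_linear_Cmult_r (form w)) _ _
    (stieltjes_integral a r phi ha r0 hphi).
rewrite left_eigenform_scal.
have -> : form J = Cmult (Cmult (RtoC (PI / sin (a * PI)))
    (polar (Rpower r (- a)) (- (a * phi)))) (form w).
  apply: is_RInt_gen_C_unique H1 _; apply: is_RInt_gen_ext_pos H2 => l l0.
  have [_ /(left_eigenform_Lambda X A n e m zeta saA Ae n0 zetan)] := hg l l0.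
  rewrite left_eigenform_minus !left_eigenform_scal zeta_polar => E.
  have nz := RtoC_plus_polar_neq0 l r phi l0 r0 hphi.
  have -> : form w = Cmult (Cplus (RtoC l) (polar r phi)) (form (g l)).
    by rewrite Cmult_plus_distr_r -E; ring.
  change (Cmult (Cmult (RtoC (Rpower l (- a))) (Cinv (Cplus (RtoC l) (polar r phi))))
    (Cmult (Cplus (RtoC l) (polar r phi)) (form (g l))) =
    Cmult (RtoC (Rpower l (- a))) (form (g l))).
  by field.
rewrite !Cmult_assoc -RtoC_mult.
have -> : sin (a * PI) / PI * (PI / sin (a * PI)) = 1 by field; lra.
by rewrite Cmult_1_l.
Qed.

(** The vector [e] is an explicit argument, shadowing the section variable, so that a scalar factor
    can be moved inside it. *)
Definition cyclic_vector (e : X) : 'I_n -> X :=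
  fun i => scal (Cpow zeta i : C_Ring) e.

Lemma scal_eigen (c : C) :
  A (scal (c : C_Ring) e) (scal (RtoC m : C_Ring) (scal (c : C_Ring) e)).
Proof.
have -> : scal (RtoC m : C_Ring) (scal (c : C_Ring) e) =
  scal (c : C_Ring) (scal (RtoC m : C_Ring) e) by inner_simpl; ring.
by case: linA => _ _ _; apply.
Qed.

Lemma scal_cyclic_vector (c : C) :
  scal (c : C_Ring) (cyclic_vector e) = cyclic_vector (scal (c : C_Ring) e).
Proof.
apply: functional_extensionality => i.
change (scal (c : C_Ring) (scal (Cpow zeta i : C_Ring) e) =
  scal (Cpow zeta i : C_Ring) (scal (c : C_Ring) e)).
by inner_simpl; ring.
Qed.

Lemma fpow_cyclic_vector (b : R) (i : 'I_n) : 0 <= b <= 1 ->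
  fpow A b (cyclic_vector e i) (scal (RtoC (Rpower m b) : C_Ring) (cyclic_vector e i)).
Proof. by move=> hb; apply: fpow_eigenvector => //; apply: scal_eigen. Qed.

Lemma Lambda_cyclic_vector :
  Lambda A n (cyclic_vector e) (scal (polar r phi : C_Ring) (cyclic_vector e)).
Proof.
rewrite -zeta_polar; split=> i.
  have nR : 0 < INR n by apply: lt_0_INR; apply/ltP.
  eexists; apply: fpow_cyclic_vector; split.
    by apply: Rdiv_le_0_compat => //; apply: pos_INR.
  apply: (Rmult_le_reg_r (INR n)) => //.
  rewrite /Rdiv Rmult_assoc Rinv_l ?Rmult_1_r ?Rmult_1_l; last lra.
  by apply: le_INR; apply/leP; apply: leq_subr.
have E : scal (Copp zeta : C_Ring) (cyclic_vector e) i =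
  scal (Copp zeta : C_Ring) (scal (Cpow zeta i : C_Ring) e) by [].
rewrite E /cyclic_vector; case: ifP => hi.
  have -> : ordS i = i.+1 :> nat by rewrite /= modn_small.
  by rewrite Cpow_S; inner_simpl; ring.
have en : n = i.+1 by apply/eqP; rewrite eqn_leq ltn_ord leqNgt hi.
have -> : ordS i = 0%N :> nat by rewrite /= -en modnn.
have -> : scal (Copp zeta : C_Ring) (scal (Cpow zeta i : C_Ring) e) =
  scal (RtoC m : C_Ring) (scal (Cpow zeta 0 : C_Ring) e); last exact: scal_eigen.
inner_simpl; rewrite Cmult_assoc.
have -> : Cmult (Copp zeta) (Cpow zeta i) = Copp (Cpow zeta n).
  by rewrite {2}en Cpow_S; ring.
by rewrite zetan RtoC_opp /=; ring.
Qed.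

(** [Ynorm] is a relation, so homogeneity is obtained by scaling the witnesses [m^t x_i] of the
    powers of [A]. *)
Lemma Ynorm_scal_cyclic_vector : exists N, 0 <= N /\
  forall c, Ynorm A (scal (c : C_Ring) (cyclic_vector e)) (Cmod c * N).
Proof.
pose w i := scal (RtoC (Rpower m (@Yexp n i)) : C_Ring) (cyclic_vector e i).
exists (sqrt (\big[Rplus/0]_(i < n) norm (w i) ^ 2)); split; first exact: sqrt_pos.
move=> c; exists (fun i => scal (c : C_Ring) (w i)); split.
  move=> i; have -> : scal (c : C_Ring) (w i) =
     scal (RtoC (Rpower m (@Yexp n i)) : C_Ring) (scal (c : C_Ring) (cyclic_vector e i)).
    by rewrite /w; inner_simpl; ring.
  apply: fpow_eigenvector => //; last exact: Yexp_itv.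
  have -> : scal (c : C_Ring) (cyclic_vector e) i =
    scal (Cmult c (Cpow zeta i) : C_Ring) e; last exact: scal_eigen.
  exact: (scal_assoc (K := C_Ring) c (Cpow zeta i) e).
rewrite -{1}(sqrt_pow2 (Cmod c)); last exact: Cmod_ge_0.
rewrite -sqrt_mult_alt; last exact: pow2_ge_0.
by rewrite Rsum_scal; congr sqrt; apply: eq_bigr => i _; rewrite norm_scal_C; ring.
Qed.

(** Continuity of [d -> d x] from C to Y: with it every convergent scalar integral gives an integral
    in Y. *)
Lemma locally_Y_cyclic_vector (c : C) (P : ('I_n -> X) -> Prop) :
  locally_Y A (scal (c : C_Ring) (cyclic_vector e)) P ->
  locally (c : C_over_R) (fun d => P (scal (d : C_Ring) (cyclic_vector e))).
Proof.
move=> [eps HP]; have [N [N0 HN]] := Ynorm_scal_cyclic_vector.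
(* A ball of C is a square in the two coordinates, so its radius controls the modulus up to
   [sqrt 2 <= 2]; [N + 1] avoids a division by zero. *)
have e0 : 0 < eps / (2 * (N + 1)) by apply: Rdiv_lt_0_compat; [exact: cond_pos | lra].
exists (mkposreal _ e0) => d hd; apply: (HP _ (Cmod (Cminus d c) * N)).
  have -> : minus (scal (d : C_Ring) (cyclic_vector e))
    (scal (c : C_Ring) (cyclic_vector e)) =
    scal (Cminus d c : C_Ring) (cyclic_vector e); last exact: HN.
  symmetry; exact: (scal_minus_distr_r (K := C_Ring) d c (cyclic_vector e)).
have h2 : Cmod (Cminus d c) < 2 * (eps / (2 * (N + 1))).
  apply: Rlt_le_trans (C_NormedModule_mixin_compat2 c d (mkposreal _ e0) hd) _ => /=.
  apply: Rmult_le_compat_r; first exact: Rlt_le.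
  rewrite -[X in _ <= X](sqrt_pow2 2); last lra.
  by apply: sqrt_le_1_alt; lra.
have E : 2 * (eps / (2 * (N + 1))) * (N + 1) = eps by field; lra.
rewrite -E; have := Cmod_ge_0 (Cminus d c); nra.
Qed.

Lemma Yspace_scal_cyclic_vector (c : C) :
  Yspace A (scal (c : C_Ring) (cyclic_vector e)).
Proof.
have [N [_ H]] := Ynorm_scal_cyclic_vector; have [w [hw _]] := H c.
by move=> i; exists (w i); apply: hw.
Qed.

Lemma is_RInt_Y_cyclic_vector (f : R -> C) (a b : R) (J : C) :
  is_RInt (V := C_over_R) f a b J ->
  is_RInt_Y A (fun l => scal (f l : C_Ring) (cyclic_vector e)) a b
    (scal (J : C_Ring) (cyclic_vector e)).
Proof.
move=> H; split; first exact: Yspace_scal_cyclic_vector.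
move=> P /locally_Y_cyclic_vector HP; have := H _ HP.
rewrite /filtermap; apply filter_imp => ptd.
have <- := Riemann_sum_morphism C_over_R (real_ModuleSpace (fct_ModuleSpace 'I_n X))
  (fun c => scal (c : C_Ring) (cyclic_vector e)).
- rewrite C_over_R_scal.
  by have -> := scal_assoc (K := C_Ring) (RtoC (sign (b - a)) : C_Ring)
    (Riemann_sum (V := C_over_R) f ptd : C_Ring) (cyclic_vector e).
- move=> x y; exact: (scal_distr_r (K := C_Ring) x y (cyclic_vector e)).
- move=> k x; rewrite C_over_R_scal.
  exact: esym (scal_assoc (K := C_Ring) (RtoC k) x (cyclic_vector e)).
Qed.

Lemma is_int_Y_cyclic_vector (f : R -> C) (J : C) :
  is_RInt_gen (V := C_over_R) f (at_right 0) (Rbar_locally p_infty) J ->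
  is_int_Y A (fun l => scal (f l : C_Ring) (cyclic_vector e))
    (scal (J : C_Ring) (cyclic_vector e)).
Proof.
move=> H; split; first exact: Yspace_scal_cyclic_vector.
move=> P /locally_Y_cyclic_vector HP.
apply: zero_infty_imp (H _ HP) => ab [y [h1 h2]].
by eexists; split; [apply: is_RInt_Y_cyclic_vector h1 | ].
Qed.
End Eigenvectors.

(** [Lambda^(-a)] is evaluated at [c^a x] rather than at [x], because its inverse then reads
    directly [Lambda^a x = c^a x]. *)
Lemma fpow_neg_cyclic_vector (X : HilbertSpace) (A : operator X) (n : nat) (e : X)
    (m : R) (zeta : C) (r phi a : R) :
  linear_operator A -> 0 < m -> A e (scal (RtoC m : C_Ring) e) -> (0 < n)%N ->
  Cpow zeta n = RtoC (- m) -> 0 < r -> - PI < phi < PI -> Copp zeta = polar r phi ->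
  0 < a < 1 ->
  fpow_neg_Y A (Lambda A n) a
    (scal (polar (Rpower r a) (a * phi) : C_Ring) (cyclic_vector X n zeta e))
    (cyclic_vector X n zeta e).
Proof.
move=> linA m0 Ae n0 zn r0 hp zp ha; have pi0 := PI_RGT_0.
have s0 : 0 < sin (a * PI) by apply: sin_gt_0; nra.
set x := cyclic_vector _ _ _ e; set c := polar _ _.
split; first exact: (Yspace_scal_cyclic_vector X A n e m zeta).
pose inv l := Cinv (Cplus (RtoC l) (polar r phi)).
pose J := Cmult (Cmult (RtoC (PI / sin (a * PI)))
    (polar (Rpower r (- a)) (- (a * phi)))) c.
exists (fun l => scal (Cmult (inv l) c : C_Ring) x), (scal (J : C_Ring) x); split.
- move=> l l0; split; first exact: (Yspace_scal_cyclic_vector X A n e m zeta).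
  rewrite /inv_op /shift_op.
  have -> : minus (scal (c : C_Ring) x)
      (scal (RtoC l : C_Ring) (scal (Cmult (inv l) c : C_Ring) x)) =
      scal (polar r phi : C_Ring) (scal (Cmult (inv l) c : C_Ring) x).
    apply: functional_extensionality => i.
    change (minus (scal (c : C_Ring) (x i))
      (scal (RtoC l : C_Ring) (scal (Cmult (inv l) c : C_Ring) (x i))) =
      scal (polar r phi : C_Ring) (scal (Cmult (inv l) c : C_Ring) (x i))).
    inner_simpl; rewrite /inv; have nz := RtoC_plus_polar_neq0 l r phi l0 r0 hp.
    by field.
  rewrite /x scal_cyclic_vector; apply: (Lambda_cyclic_vector X A n _ m) => //.
  exact: scal_eigen.
- have H := is_RInt_gen_linear _ _ _ (is_linear_Cmult_r c) _ _
    (stieltjes_integral a r phi ha r0 hp).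
  have := is_int_Y_cyclic_vector X A n e m zeta linA m0 Ae _ _ H.
  congr (is_int_Y A _ _); apply: functional_extensionality => l.
  have -> := scal_assoc (K := C_Ring) (RtoC (Rpower l (- a)) : C_Ring)
    (Cmult (inv l) c : C_Ring) x.
  by congr (scal _ x); rewrite /inv; apply: esym; apply: Cmult_assoc.
have -> := scal_assoc (K := C_Ring) (RtoC (sin (a * PI) / PI) : C_Ring) (J : C_Ring) x.
have -> : mult (RtoC (sin (a * PI) / PI) : C_Ring) (J : C_Ring) = (one : C_Ring).
  change (Cmult (RtoC (sin (a * PI) / PI)) J = RtoC 1).
  rewrite /J -Cmult_assoc /c polar_mult -Rpower_plus !Rplus_opp_l.
  rewrite Rpower_O // polar_0 Cmult_1_r -RtoC_mult; congr RtoC; field; lra.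
exact: esym (scal_one (K := C_Ring) x).
Qed.

(** * The n roots of [- r^n] and the orthogonality of their powers *)

Section RootsOfMinus.
Variables (n : nat) (r : R).
Hypothesis n0 : (0 < n)%N.
Hypothesis r0 : 0 < r.

Definition root_of_minus (k : nat) : C := polar r (PI * (2 * INR k + 1) / INR n).

Let nR : 0 < INR n.
Proof. by apply: lt_0_INR; apply/ltP. Qed.

Lemma root_of_minus_pow (k : nat) : Cpow (root_of_minus k) n = RtoC (- r ^ n).
Proof.
rewrite polar_pow.
have -> : INR n * (PI * (2 * INR k + 1) / INR n) = 2 * PI * INR k + PI by field; lra.
by rewrite -polar_opp polar_2PI RtoC_opp.
Qed.

Lemma sum_geometric (w : C) (k : nat) :
  Cmult (Cminus w (RtoC 1)) (\big[Cplus/RtoC 0]_(i < k) Cpow w i) =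
  Cminus (Cpow w k) (RtoC 1).
Proof.
elim: k => [|k IH]; first by rewrite big_ord0 /=; ring.
by rewrite big_ord_recr /= Cmult_plus_distr_l IH; ring.
Qed.

(** Up to a constant factor this is a geometric sum of ratio [w = e^(2 i PI q / n)] with [w^n = 1].
    The range of [q] excludes [w = 1]: it would mean [sin x = 0] for [x = PI q / n] in (0, 2 PI)
    other than [PI]. *)
Lemma sum_root_of_minus_pow (q : nat) : (0 < q < n + n)%N -> q != n ->
  \big[Cplus/RtoC 0]_(k < n) Cpow (root_of_minus k) q = RtoC 0.
Proof.
move=> /andP[q0 q2] qn; have pi0 := PI_RGT_0.
pose w := polar 1 (2 * PI * INR q / INR n).
have -> : \big[Cplus/RtoC 0]_(k < n) Cpow (root_of_minus k) q =
  Cmult (polar (r ^ q) (INR q * (PI / INR n))) (\big[Cplus/RtoC 0]_(k < n) Cpow w k).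
  rewrite Cmult_sum; apply: eq_bigr => k _.
  rewrite !polar_pow polar_mult pow1 Rmult_1_r; congr (polar _); field; lra.
have h := sum_geometric w n.
have wn : Cpow w n = RtoC 1.
  rewrite polar_pow pow1.
  have -> : INR n * (2 * PI * INR q / INR n) = 2 * PI * INR q by field; lra.
  exact: polar_2PI.
have [w1|->] : Cminus w (RtoC 1) = RtoC 0 \/ \big[Cplus/RtoC 0]_(k < n) Cpow w k = RtoC 0.
- by apply: Cmult_integral; rewrite h wn; ring.
- pose x := PI * INR q / INR n.
  have qp : 0 < INR q by apply: lt_0_INR; apply/ltP.
  have x0 : 0 < x by apply: Rdiv_lt_0_compat => //; nra.
  have x2 : x < 2 * PI.
    apply: (Rmult_lt_reg_r (INR n)) => //.
    have -> : x * INR n = PI * INR q by rewrite /x; field; lra.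
    have : INR q < INR n + INR n by rewrite -plus_INR; apply: lt_INR; apply/ltP.
    by move=> ?; nra.
  have s : sin x = 0.
    have := f_equal fst w1; rewrite /w /polar /Cminus /Cplus /Copp /RtoC /=.
    have -> : 2 * PI * INR q / INR n = 2 * x by rewrite /x /Rdiv; ring.
    by rewrite cos_2a_sin; nra.
  have xp : x <> PI.
    move=> e; move/eqP: qn; apply; apply: INR_eq.
    apply: (Rmult_eq_reg_l PI); last lra.
    by rewrite -{2}e /x; field; lra.
  have [lt|ge] := Rlt_le_dec x PI.
    by have := sin_gt_0 x x0 lt; lra.
  by have := sin_lt_0 x (ltac:(lra)) x2; lra.
by rewrite Cmult_0_r.
Qed.

(** Inversion of a discrete Fourier transform: after multiplying by the power [j + 1] of each root
    and summing over the roots, the exponents [n + j - i] lie between 1 and [2 n - 1], and only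
    [i = j] gives [n]. What survives is [- n r^n c_j]. *)
Lemma polynomial_roots_of_minus (c : 'I_n -> C) :
  (forall k, (k < n)%N ->
    \big[Cplus/RtoC 0]_(i < n) Cmult (Cpow (root_of_minus k) (n - 1 - i)) (c i) = RtoC 0) ->
  forall j, c j = RtoC 0.
Proof.
move=> H j.
have : \big[Cplus/RtoC 0]_(k < n) Cmult (Cpow (root_of_minus k) j.+1)
  (\big[Cplus/RtoC 0]_(i < n) Cmult (Cpow (root_of_minus k) (n - 1 - i)) (c i)) = RtoC 0.
  by apply: big1 => k _; rewrite H // Cmult_0_r.
have -> : \big[Cplus/RtoC 0]_(k < n) Cmult (Cpow (root_of_minus k) j.+1)
  (\big[Cplus/RtoC 0]_(i < n) Cmult (Cpow (root_of_minus k) (n - 1 - i)) (c i)) =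
  \big[Cplus/RtoC 0]_(i < n) Cmult (c i)
    (\big[Cplus/RtoC 0]_(k < n) Cpow (root_of_minus k) (j.+1 + (n - 1 - i))).
  under eq_bigr => k _ do rewrite Cmult_sum.
  rewrite exchange_big /=; apply: eq_bigr => i _.
  rewrite Cmult_sum; apply: eq_bigr => k _.
  by rewrite Cpow_add_r; ring.
have hexp (i : 'I_n) : (j.+1 + (n - 1 - i) = n + j - i)%N.
  have := ltn_ord i; have := ltn_ord j; move: (nat_of_ord i) (nat_of_ord j) => p q.
  move=> /ltP hp /ltP hq; rewrite -plusE -!minusE; lia.
rewrite (bigD1 j) // [\big[_/_]_(i < n | i != j) _]big1 => [|i ij].
  change (Cplus (Cmult (c j) (\big[Cplus/RtoC 0]_(k < n)
    Cpow (root_of_minus k) (j.+1 + (n - 1 - j)))) (RtoC 0) = RtoC 0 -> c j = RtoC 0).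
  rewrite Cplus_0_r hexp addnK.
  have -> : \big[Cplus/RtoC 0]_(k < n) Cpow (root_of_minus k) n =
    RtoC (INR n * (- r ^ n)).
    under eq_bigr => k _ do rewrite root_of_minus_pow.
    move: (- r ^ n) => y; elim: (n) => [|p IH].
      by rewrite big_ord0 /= Rmult_0_l.
    rewrite big_ord_recr IH S_INR.
    change (Cplus (RtoC (INR p * y)) (RtoC y) = RtoC ((INR p + 1) * y)).
    by rewrite -RtoC_plus; congr RtoC; ring.
  move=> /Cmult_integral [] // /RtoC_inj.
  have := pow_lt r n r0 => ?; nra.
rewrite sum_root_of_minus_pow ?Cmult_0_r //.
  rewrite hexp; have := ltn_ord i; have := ltn_ord j.
  move: (nat_of_ord i) (nat_of_ord j) => p q /ltP hp /ltP hq.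
  by apply/andP; split; apply/ltP; rewrite -?plusE -?minusE; lia.
rewrite hexp; apply/eqP => h; move/eqP: ij; apply; apply: val_inj => /=.
have := ltn_ord i; have := ltn_ord j; move: h.
move: (nat_of_ord i) (nat_of_ord j) => p q; rewrite -?plusE -?minusE.
move=> h /ltP hp /ltP hq; lia.
Qed.

End RootsOfMinus.

(** * The point spectrum, indexed by all n roots *)

Lemma point_spectrum_fpow_Lambda (X : HilbertSpace) (A : operator X) (lambda0 : R)
    (mu : nat -> R) (n : nat) (alpha : R) :
  linear_operator A -> self_adjoint A -> positive_definite A -> 0 < lambda0 ->
  (forall z : C, spectrum A z -> lambda0 < Re z) -> compact_resolvent A ->
  ordered_eigenvalues A mu -> (0 < n)%N -> 0 < alpha <= 1 ->
  forall z : C,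
    point_spectrum (opp_op (fpow_Y A (Lambda A n) alpha)) z <->
    exists j k : nat, (k < n)%N /\
      z = polar (Rpower (mu j) (alpha / INR n))
            (PI * (INR n - (INR n - 2 * INR k - 1) * alpha) / INR n).
Proof.
move=> linA saA pdA l0 spec compA eigA n0 ha z; have pi0 := PI_RGT_0.
have nR : 0 < INR n by apply: lt_0_INR; apply/ltP.
(* [ph k] is the principal argument of [- zeta] for the root [zeta] of index [k]. *)
pose ph k := PI * (2 * INR k + 1) / INR n - PI.
have facts m k : 0 < m -> (k < n)%N ->
  [/\ Cpow (root_of_minus n (Rpower m (/ INR n)) k) n = RtoC (- m),
      0 < Rpower m (/ INR n), - PI < ph k < PI &
      Copp (root_of_minus n (Rpower m (/ INR n)) k) = polar (Rpower m (/ INR n)) (ph k)].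
  move=> m0 kn; split.
  - rewrite root_of_minus_pow // -Rpower_pow; last exact: exp_pos.
    by rewrite Rpower_mult Rinv_l ?Rpower_1 //; lra.
  - exact: exp_pos.
  - have k0 := pos_INR k.
    have k1 : INR k + 1 <= INR n by rewrite -S_INR; apply: le_INR; apply/leP.
    have E : ph k * INR n = PI * (2 * INR k + 1 - INR n) by rewrite /ph; field; lra.
    split; apply: (Rmult_lt_reg_r (INR n)) => //; rewrite E; nra.
  (* Negation yields the argument [t + PI], one full turn above [ph k = t - PI]. *)
  - rewrite /root_of_minus /ph polar_opp /polar; set t := PI * _ / _.
    have -> : t + PI = t - PI + 2 * INR 1 * PI by rewrite /=; ring.
    by rewrite cos_period sin_period.
have value m k : polar (Rpower (Rpower m (/ INR n)) alpha) (alpha * ph k + PI) =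
    polar (Rpower m (alpha / INR n))
      (PI * (INR n - (INR n - 2 * INR k - 1) * alpha) / INR n).
  rewrite Rpower_mult; congr (polar (Rpower _ _) _); first by field; lra.
  by rewrite /ph; field; lra.
split.
- move=> [x x0 hx].
  have [i xi] : exists i, x i <> zero.
    apply: NNPP => H; apply: x0; apply: functional_extensionality => i.
    by apply: NNPP => xi; apply: H; exists i.
  have [e [c [Ae xe]]] : exists (e : X) (c : C), A e (scal (c : C_Ring) e) /\
      inner (x i) e <> RtoC 0.
    apply: NNPP => H; apply: xi.
    apply: (eigenvectors_complete X A lambda0) => // e c Ae.
    by apply: NNPP => xe; apply: H; exists e, c.
  have e0 : e <> zero.
    by move=> e0; apply: xe; rewrite e0 inner_conj inner_zero_l /Cconj /RtoC /= Ropp_0.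
  have [j cj] := ordered_eigenvalues_all X A mu c e eigA Ae e0.
  rewrite cj in Ae; have m0 := eigenvalue_gt0 X A (mu j) e pdA Ae e0.
  pose r := Rpower (mu j) (/ INR n).
  have r0 : 0 < r by apply: exp_pos.
  have [k [kn hk]] : exists k, (k < n)%N /\
      left_eigenform X n e (root_of_minus n r k) x <> RtoC 0.
    apply: NNPP => H; apply: xe.
    apply: (polynomial_roots_of_minus n r n0 r0 (fun i => inner (x i) e)) => k kn.
    by apply: NNPP => hk; apply: H; exists k.
  exists j, k; split => //; rewrite -value.
  have [zn _ hp zp] := facts (mu j) k m0 kn; rewrite -/r in zn zp *.
  move: hx; rewrite /opp_op /fpow_Y.
  set L := left_eigenform _ _ _ _ in hk.
  have Lx : L (opp (scal (z : C_Ring) x)) = Cmult (Copp z) (L x).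
    have -> : opp (scal (z : C_Ring) x) = scal (Copp z : C_Ring) x.
      exact: esym (scal_opp_l (K := C_Ring) z x).
    exact: left_eigenform_scal.
  rewrite -polar_opp.
  (* For [alpha = 1] the power is [Lambda] itself and the form applies directly; otherwise the
     relation reads [Lambda^(-alpha) (- z x) = x]. *)
  case: Req_EM_T => /= [a1|a1].
    move=> /(left_eigenform_Lambda X A n e (mu j) _ saA Ae n0 zn); rewrite -/L Lx.
    rewrite a1 Rpower_1 // Rmult_1_l -zp => h.
    have : Cmult (Cminus z (root_of_minus n r k)) (L x) = RtoC 0.
      have -> : Cmult (Cminus z (root_of_minus n r k)) (L x) =
        Cminus (Cmult (Copp (root_of_minus n r k)) (L x)) (Cmult (Copp z) (L x)) by ring.
      by rewrite -h; ring.
    move=> /Cmult_integral [] // h'.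
    have -> : z = Cplus (Cminus z (root_of_minus n r k)) (root_of_minus n r k) by ring.
    by rewrite h'; ring.
  have ha' : 0 < alpha < 1 by lra.
  move=> /(left_eigenform_fpow_neg X A n e (mu j) _ r (ph k) saA m0 Ae n0 zn
    r0 hp zp alpha _ _ ha').
  rewrite -/L Lx => h.
  pose p := polar (Rpower r alpha) (alpha * ph k).
  have hpp : Cmult p (polar (Rpower r (- alpha)) (- (alpha * ph k))) = RtoC 1.
    by rewrite /p polar_mult -Rpower_plus !Rplus_opp_r Rpower_O // polar_0.
  have h2 : Cmult p (L x) = Cmult (Copp z) (L x).
    by rewrite {1}h Cmult_assoc hpp; ring.
  have : Cmult (Cplus p z) (L x) = RtoC 0.
    by rewrite Cmult_plus_distr_r h2; ring.
  move=> /Cmult_integral [] // h'.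
  have -> : z = Cminus (Cplus p z) p by ring.
  by rewrite h' -/p; ring.
move=> [j [k [kn ->]]].
have [e Ae e0] := ordered_eigenvalues_ex X A mu j eigA.
have m0 := eigenvalue_gt0 X A (mu j) e pdA Ae e0.
have [zn r0 hp zp] := facts (mu j) k m0 kn.
rewrite -value; set r := Rpower (mu j) (/ INR n) in zn r0 zp *.
set zeta := root_of_minus n r k in zn zp.
exists (cyclic_vector X n zeta e).
  (* Component 0 of the vector is [zeta^0 e = e]. *)
  move=> h; have := f_equal (fun f => f (Ordinal n0)) h.
  rewrite /cyclic_vector /= => h'; apply: e0.
  exact: etrans (esym (scal_one (K := C_Ring) e)) h'.
rewrite /opp_op -polar_opp.
have -> : opp (scal (Copp (polar (Rpower r alpha) (alpha * ph k)) : C_Ring)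
    (cyclic_vector X n zeta e)) =
  scal (polar (Rpower r alpha) (alpha * ph k) : C_Ring) (cyclic_vector X n zeta e).
  apply: functional_extensionality => i.
  change (opp (scal (Copp (polar (Rpower r alpha) (alpha * ph k)) : C_Ring)
    (cyclic_vector X n zeta e i)) =
    scal (polar (Rpower r alpha) (alpha * ph k) : C_Ring) (cyclic_vector X n zeta e i)).
  by inner_simpl; ring.
rewrite /fpow_Y; case: Req_EM_T => /= [a1|a1].
  rewrite a1 Rpower_1 // Rmult_1_l.
  exact: (Lambda_cyclic_vector X A n e (mu j)).
by apply: (fpow_neg_cyclic_vector X A n e (mu j)) => //; lra.
Qed.

Theorem theorem1p3 (X : HilbertSpace) (A : operator X) (lambda0 : R)
    (mu : nat -> R) (n : nat) (alpha : R) :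
  separable X ->
  linear_operator A ->
  ~ bounded_operator A ->
  closed_operator A ->
  densely_defined A ->
  self_adjoint A ->
  positive_definite A ->
  0 < lambda0 ->
  (forall z : C, spectrum A z -> lambda0 < Re z) ->
  compact_resolvent A ->
  ordered_eigenvalues A mu ->
  (3 <= n)%N ->
  0 < alpha <= 1 ->
  forall z : C,
    point_spectrum (opp_op (fpow_Y A (Lambda A n) alpha)) z <->
    exists k : nat, (k <= (n - 1) %/ 2)%N /\
      ((exists j : nat,
          z = polar (Rpower (mu j) (alpha / INR n))
                (PI * (INR n - (INR n - 2 * INR k - 1) * alpha) / INR n)) \/
       (exists j : nat,
          z = polar (Rpower (mu j) (alpha / INR n))
                (PI * (INR n + (INR n - 2 * INR k - 1) * alpha) / INR n))).
Proof.
move=> _ linA _ _ _ saA pdA l0 spec compA eigA n3 ha z.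
have n0 : (0 < n)%N by apply: leq_trans n3.
have nR : 0 < INR n by apply: lt_0_INR; apply/ltP.
rewrite (point_spectrum_fpow_Lambda X A lambda0 mu) //.
have refl k : (k < n)%N -> INR (n - 1 - k) = INR n - 1 - INR k.
  move=> kn; rewrite -subnDA minus_INR ?plus_INR; last by apply/leP; rewrite add1n.
  by rewrite /=; lra.
have half k : (k <= (n - 1) %/ 2)%N = (2 * k <= n - 1)%N by rewrite leq_divRL // mulnC.
split.
(* The reflection [k -> n - 1 - k] changes the sign of [n - 2 k - 1] and exchanges the two families;
   it brings every index above [(n - 1) / 2] back into the allowed range. *)
- move=> [j [k [kn ->]]]; case: (leqP k ((n - 1) %/ 2)) => hk.
    by exists k; split => //; left; exists j.
  exists (n - 1 - k)%N; split.
    move: hk; rewrite ltnNge !half => /leP hk; apply/leP.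
    by move: hk; rewrite -?multE -?minusE; move/ltP: kn; lia.
  right; exists j; congr (polar _ _); rewrite refl //; field; lra.
move=> [k [hk h]].
have kn : (k < n)%N.
  by move: hk; rewrite half => /leP; rewrite -multE -minusE; move/ltP: n0 => ? ?; apply/ltP; lia.
case: h => [[j ->]|[j ->]]; first by exists j, k.
exists j, (n - 1 - k)%N; split.
  by apply/ltP; rewrite -?minusE; move/ltP: n0; lia.
by congr (polar _ _); rewrite refl //; field; lra.
Qed.
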